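(* Let $f(z)=z+\sum_{n=2}^{\infty}a_nz^n$ be typically real in $\mathbb{D}$, let $\Phi:[0,1]\to[0,\infty)$ be a continuous increasing function and let $\omega$ be a Schwarz function. Let $R$ be the unique root in $(0,1)$ of $F(r)=0$, where $$F(r)=\frac{r}{(1-r)^2}+\Phi(r)\frac{r^4(r^4-3r^2+4)}{1-3r^2+3r^4-r^6}-\frac14.$$ Then $$|\omega(z)|+\sum_{n=2}^{\infty}|a_n||\omega(z)|^n+\Phi(|\omega(z)|)\sum_{n=2}^{\infty}|a_n|^2|\omega(z)|^{2n}\le d(0,\partial f(\mathbb{D}))$$ for all $z\in\mathbb{D}$ with $|z|\le R$. The radius $R$ is sharp.
   Context: $\mathbb{D}=\{z\in\mathbb{C}:|z|<1\}$. An analytic function $f(z)=z+\sum_{n\ge2}a_nz^n$ on $\mathbb{D}$ is typically real if $\operatorname{Im} f(z)\cdot\operatorname{Im} z>0$ for all non-real $z\in\mathbb{D}$. A Schwarz function is an analytic $\omega:\mathbb{D}\to\mathbb{D}$ with $\omega(0)=0$. $d(0,\partial f(\mathbb{D}))$ is the Euclidean distance from $0$ to $\partial f(\mathbb{D})$. *)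

(* Defs.v *)
From HB Require Import structures.
From mathcomp Require Import all_boot all_order all_algebra.
From mathcomp Require Import all_classical all_reals all_analysis.
From mathcomp Require Export complex.
Import Order.TTheory GRing.Theory Num.Theory.
Import numFieldNormedType.Exports.

Set Implicit Arguments.
Unset Strict Implicit.
Unset Printing Implicit Defensive.

Local Open Scope ring_scope.
Local Open Scope classical_set_scope.

Notation normc := ComplexField.Normc.normc.

Definition cdisk (R : realType) : set R[i] := [set z | normc z < 1].

(* f is analytic (complex differentiable) at every point of D.
   R[i]^o is R[i] viewed as a normed module over itself. *)
Definition holomorphic_on_disk (R : realType) (f : R[i] -> R[i]) : Prop :=
  forall z : R[i], normc z < 1 -> derivable (f : R[i]^o -> R[i]^o) z 1.

Definition power_series_rep (R : realType) (a : nat -> R[i]) (f : R[i] -> R[i]) : Prop :=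
  forall z : R[i], normc z < 1 ->
    (fun N : nat => (z + \sum_(2 <= n < N) a n * z ^+ n : R[i]^o)) @ \oo --> (f z : R[i]^o).

Definition typically_real (R : realType) (f : R[i] -> R[i]) : Prop :=
  forall z : R[i], normc z < 1 -> complex.Im z != 0 ->
    0 < complex.Im (f z) * complex.Im z.

Definition schwarz (R : realType) (w : R[i] -> R[i]) : Prop :=
  [/\ holomorphic_on_disk w, w 0 = 0 & forall z : R[i], normc z < 1 -> normc (w z) < 1].

(* Euclidean distance from 0 to the boundary of f(D), as an extended real
   (infimum of |w| over w in boundary = closure minus interior; +oo if empty). *)
Definition dist0_boundary (R : realType) (f : R[i] -> R[i]) : \bar R :=
  let A : set R[i]^o := f @` @cdisk R in
  ereal_inf [set (normc w)%:E | w in closure A `\` interior A].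

Definition Ffun (R : realType) (Phi : R -> R) (r : R) : R :=
  r / (1 - r) ^+ 2
  + Phi r * (r ^+ 4 * (r ^+ 4 - 3 * r ^+ 2 + 4) / (1 - 3 * r ^+ 2 + 3 * r ^+ 4 - r ^+ 6))
  - 1 / 4.

(* Left-hand side of the inequality, as an extended real
   (the series have nonnegative terms, so they always have a value in [0,+oo]). *)
Definition lhs (R : realType) (Phi : R -> R) (a : nat -> R[i]) (x : R) : \bar R :=
  (x%:E + (\sum_(2 <= n <oo) (normc (a n) * x ^+ n)%:E)
   + (Phi x)%:E * (\sum_(2 <= n <oo) (normc (a n) ^+ 2 * x ^+ (2 * n))%:E))%E.

(* Main.v *)
Require Import Defs.
From HB Require Import structures.
From mathcomp Require Import all_boot all_order all_algebra all_field.
From mathcomp Require Import all_classical all_reals all_analysis.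
From mathcomp Require Import complex ring lra.
Import Order.TTheory GRing.Theory Num.Theory.
Import numFieldNormedType.Exports.
Import ComplexField.Normc.
Local Open Scope ring_scope.
Local Open Scope classical_set_scope.
Local Open Scope complex_scope.

(** The Schwarz lemma gives [|w(z)| <= |z| <= R], and the coefficients of a
typically real function satisfy [|a_n| <= n], so the left-hand side is at most
[F(R) + 1/4 = 1/4]. It remains to see that the image contains the disk of
radius 1/4. If [f] omits [w = u + iv] with [v > 0], then
[h = -i (log(1 - f/w) - log(1 - f/conj w))] is typically real up to a factor,
[h'(0) = 2v/|w|^2], and on the real axis
[h = 2 (atan((f - u)/v) + atan(u/v))], so that [h(1) <= 2X] and
[- h(-1) <= 2Y] with [X + Y = pi]. For a typically real function the Robertson
kernel bounds [p^2 h(1) - q^2 h(-1)] below by [h'(0) (p + q)^2 / 4]; taking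
[p = 1/X] and [q = 1/Y] this becomes [|w| >= v pi / (4 |w| X Y)], which is at
least 1/4 since [X Y <= pi sin X]. The function [f] is first replaced by a
truncation of its Taylor series, so that the logarithms split into
[log(1 - g z)] over the inverse roots [g], and all integrals over circles are
replaced by averages over roots of unity. The Schwarz lemma is derived from
Goursat's bisection in logarithmic polar coordinates. The Koebe function
[z/(1 - z)^2], which omits [-1/4], gives the sharpness. *)

Set Implicit Arguments.
Unset Strict Implicit.

(** Positivity of [h] has a geometric reason: [Im h = log |f - conj w| - log |f - w|], and a point
    of the upper half-plane is at least as close to [w] as to [conj w]. The kernel bound is a
    duality: for real sequences [b] and [c], the sum of [b n * c n] is twice the average over the
    unit circle of the product of the imaginary parts of the two series, hence nonnegative when both
    have the sign of [Im z]. This replaces the integral representation of typically real functions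
    and also yields the coefficient bound. The dual kernel combines the geometric series at [x] and
    [- x] and subtracts a multiple of [z]; the admissible multiple is [(p + q)^2 x / (2 (1 + x^2))],
    which tends to [(p + q)^2 / 4] as [x] tends to 1. The weights [1/X] and [1/Y] are the optimal
    ones, since they minimise [(p^2 X + q^2 Y) / (p + q)^2]. The obstacle is that truncating a
    series destroys its sign near the real axis; adding a small multiple of [z] repairs it, because
    [|Im (z^n)| <= n |Im z|] makes the lost tail proportional to [Im z]. *)

Local Notation Re := complex.Re.
Local Notation Im := complex.Im.

(** * Complex numbers and their topology *)

Section Complex.
Variable R : realType.
Implicit Types (z u : R[i]) (x e : R).

Lemma half_gt0 e : 0 < e -> 0 < e / 2.
Proof. by move=> e0; rewrite divr_gt0. Qed.

Lemma normr_normc z : `|z| = (normc z)%:C.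
Proof. by rewrite normc_def; case: z. Qed.

Lemma normc_ge0 z : 0 <= normc z.
Proof. by case: z => a b /=; exact: sqrtr_ge0. Qed.

Lemma normc_eq0 z : (normc z == 0) = (z == 0).
Proof. by apply/eqP/eqP => [/eq0_normc|->]; rewrite ?normc0. Qed.

Lemma normc_gt0 z : (0 < normc z) = (z != 0).
Proof. by rewrite lt_neqAle normc_ge0 andbT eq_sym normc_eq0. Qed.

Lemma sqr_normcE z : normc z ^+ 2 = Re z ^+ 2 + Im z ^+ 2.
Proof. by case: z => a b /=; rewrite sqr_sqrtr // addr_ge0 ?sqr_ge0. Qed.

Lemma normc_conj z : normc z^* = normc z.
Proof. by case: z => a b /=; rewrite sqrrN. Qed.

Lemma normcX z n : normc (z ^+ n) = normc z ^+ n.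
Proof. by elim: n => [|n IH]; rewrite ?expr0 ?normc1// !exprS normcM IH. Qed.

Lemma normcR x : normc x%:C = `|x|.
Proof. by rewrite /= expr0n addr0 sqrtr_sqr. Qed.

Lemma normcB z u : normc (z - u) = normc (u - z).
Proof. by rewrite -normcN opprB. Qed.

Lemma ler_normcB z u : normc z - normc u <= normc (z - u).
Proof. by rewrite lerBlDr; have := le_normcD (z - u) u; rewrite subrK. Qed.

Lemma normr_Re z : `|Re z| <= normc z.
Proof.
rewrite -(@ler_pXn2r _ 2) ?nnegrE ?normc_ge0// sqr_normcE.
by rewrite real_normK ?num_real// lerDl sqr_ge0.
Qed.

Lemma normr_Im z : `|Im z| <= normc z.
Proof.
rewrite -(@ler_pXn2r _ 2) ?nnegrE ?normc_ge0// sqr_normcE.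
by rewrite real_normK ?num_real// lerDr sqr_ge0.
Qed.

Lemma normc_ReIm z : normc z <= `|Re z| + `|Im z|.
Proof.
rewrite {1}[z]complexE; apply: (le_trans (le_normcD _ _)).
by rewrite normcM !normcR lerD2l /= expr0n expr1n add0r sqrtr1 mul1r.
Qed.

Lemma normc_sum (I : Type) (s : seq I) (P : pred I) (F : I -> R[i]) :
  normc (\sum_(i <- s | P i) F i) <= \sum_(i <- s | P i) normc (F i).
Proof.
elim/big_ind2: _ => [|x1 x2 y1 y2 h1 h2|//]; first by rewrite normc0.
exact: (le_trans (le_normcD _ _) (lerD h1 h2)).
Qed.

Lemma cReD z u : Re (z + u) = Re z + Re u. Proof. by case: z; case: u. Qed.
Lemma cImD z u : Im (z + u) = Im z + Im u. Proof. by case: z; case: u. Qed.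
Lemma cReN z : Re (- z) = - Re z. Proof. by case: z. Qed.
Lemma cImN z : Im (- z) = - Im z. Proof. by case: z. Qed.
Lemma cReM z u : Re (z * u) = Re z * Re u - Im z * Im u.
Proof. by case: z; case: u. Qed.
Lemma cImM z u : Im (z * u) = Re z * Im u + Im z * Re u.
Proof. by case: z; case: u => *; rewrite /= addrC. Qed.
Lemma cReZ x z : Re (x%:C * z) = x * Re z. Proof. by rewrite cReM /= mul0r subr0. Qed.
Lemma cImZ x z : Im (x%:C * z) = x * Im z. Proof. by rewrite cImM /= mul0r addr0. Qed.

Lemma cRe_sum (I : Type) (s : seq I) (P : pred I) (F : I -> R[i]) :
  Re (\sum_(i <- s | P i) F i) = \sum_(i <- s | P i) Re (F i).
Proof. by elim/big_rec2: _ => // i a b _; rewrite cReD => ->. Qed.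
Lemma cIm_sum (I : Type) (s : seq I) (P : pred I) (F : I -> R[i]) :
  Im (\sum_(i <- s | P i) F i) = \sum_(i <- s | P i) Im (F i).
Proof. by elim/big_rec2: _ => // i a b _; rewrite cImD => ->. Qed.

Lemma mulc_conj z : z * z^*%C = (normc z ^+ 2)%:C.
Proof.
rewrite sqr_normcE; case: z => a b; apply/eqP; rewrite eq_complex /=.
by apply/andP; split; apply/eqP; ring.
Qed.

Lemma invc_normc1 z : normc z = 1 -> z^-1 = z^*%C.
Proof.
move=> h; have := mulc_conj z; rewrite h expr1n => hz.
have z0 : z != 0 by rewrite -normc_gt0 h.
by apply: (mulfI z0); rewrite divff// hz.
Qed.

Lemma gtc0_norm z : (0 < z) -> z = (Re z)%:C /\ 0 < Re z.
Proof. by rewrite ltcE; case: z => a b /= /andP[/eqP -> ->]. Qed.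

(** Balls of [R[i]^o] have their radii in [R[i]], where a positive element is a real number; this is
    the passage to real radii on which the later epsilon-delta arguments rest. *)
Lemma nbhs_normcP z (P : set R[i]^o) :
  nbhs (z : R[i]^o) P <-> exists2 e : R, 0 < e & forall u, normc (u - z) < e -> P u.
Proof.
split.
  move=> /nbhs_ballP[e /= e0 he]; have [eE re0] := gtc0_norm e0.
  exists (Re e) => // u hu; apply: he.
  by rewrite -ball_normE /ball_ /= distrC normr_normc eE ltcR.
move=> [e e0 he]; apply/nbhs_ballP; exists e%:C; first by rewrite /= ltcR.
move=> u; rewrite -ball_normE /ball_ /= distrC normr_normc ltcR; exact: he.
Qed.

Lemma cvg_normcP (T : Type) (F : set_system T) {FF : Filter F} (f : T -> R[i]) z :
  (f : T -> R[i]^o) @ F --> (z : R[i]^o) <->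
  forall e, 0 < e -> \forall t \near F, normc (f t - z) < e.
Proof.
split.
  move=> h e e0; apply: (h [set u | normc (u - z) < e]).
  by apply/nbhs_normcP; exists e.
move=> h P /nbhs_normcP[e e0 he]; near=> t; apply: he; near: t; exact: h.
Unshelve. all: by end_near. Qed.

Lemma cvgn_normcP (f : nat -> R[i]) z :
  (f : nat -> R[i]^o) @ \oo --> (z : R[i]^o) <->
  forall e, 0 < e -> exists N, forall n, (N <= n)%N -> normc (f n - z) < e.
Proof.
split=> [/cvg_normcP h e e0|h].
  by have [N _ hN] := h e e0; exists N => n; exact: hN.
by apply/cvg_normcP => e e0; have [N hN] := h e e0; exists N.
Qed.

Lemma continuous_normcP (f : R[i] -> R[i]) z :
  {for z, continuous (f : R[i]^o -> R[i]^o)} <->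
  forall e, 0 < e -> exists2 d, 0 < d &
    forall u, normc (u - z) < d -> normc (f u - f z) < e.
Proof.
have H := @cvg_normcP _ (nbhs (z : R[i]^o)) _ f (f z).
split=> [/H h e /h /nbhs_normcP//|h].
by apply/H => e /h ?; apply/nbhs_normcP.
Qed.

Lemma derivable_normcP (f : R[i] -> R[i]) z :
  derivable (f : R[i]^o -> R[i]^o) z 1 <->
  exists d : R[i], forall e, 0 < e -> exists2 del, 0 < del &
    forall h, normc h < del -> normc (f (z + h) - f z - d * h) <= e * normc h.
Proof.
split; last first.
  move=> [d hd]; apply/cvg_ex; exists d; apply/(cvg_normcP _ d) => e e0.
  have [del del0 hdel] := hd _ (half_gt0 e0).
  apply/nbhs_normcP; exists del => // h; rewrite subr0 => hh h0 /=.
  set q := _ *: _; have -> : q - d = (f (z + h) - f z - d * h) / h.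
    by rewrite /q /= [h *: 1]mulr1 [_ *: _]mulrC [RHS]mulrBl mulfK// [h + z]addrC.
  have nh : 0 < normc h by rewrite normc_gt0.
  rewrite normcM normcV ltr_pdivrMr//; apply: (le_lt_trans (hdel h hh)).
  by rewrite ltr_pM2r// ltr_pdivrMr// ltr_pMr// ltr1n.
case/cvg_ex => /= d /(cvg_normcP _ d) hd; exists d => e e0.
have /nbhs_normcP[del del0 hdel] := hd e e0.
exists del => // h hh; have [->|h0] := eqVneq h 0.
  by rewrite addr0 subrr mulr0 subr0 normc0 mulr0.
have := hdel h; rewrite subr0 => /(_ hh h0) /=.
set q := _ *: _ => hq; have -> : f (z + h) - f z - d * h = (q - d) * h.
  by rewrite /q /= [h *: 1]mulr1 [_ *: _]mulrC mulrBl divfK// [h + z]addrC.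
by rewrite normcM ler_wpM2r ?normc_ge0// ltW.
Qed.

Lemma derivable_shift (f : R[i] -> R[i]) c z :
  derivable (f : R[i]^o -> R[i]^o) (c + z) 1 ->
  derivable ((fun u => f (c + u)) : R[i]^o -> R[i]^o) z 1.
Proof.
move=> /derivable_normcP[d hd]; apply/derivable_normcP; exists d => e /hd[t t0 ht].
by exists t => // h /ht; rewrite addrA.
Qed.

Lemma derivable_continuous_normc (f : R[i] -> R[i]) z :
  derivable (f : R[i]^o -> R[i]^o) z 1 ->
  {for z, continuous (f : R[i]^o -> R[i]^o)}.
Proof. by move=> /derivable1_diffP; exact: differentiable_continuous. Qed.

(** Compactness is taken from [R * R]: the disk is a closed subset of a square, and the coordinates
    carry the maximum back to [R[i]]. *)
Lemma closed_disk_max (g : R[i] -> R) r : 0 <= r ->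
  (forall z, normc z <= r -> forall e, 0 < e -> exists2 d, 0 < d &
    forall u, normc (u - z) < d -> `|g u - g z| < e) ->
  exists2 z, normc z <= r & forall u, normc u <= r -> g u <= g z.
Proof.
move=> r0 cg.
pose K := (`[-r, r] `*` `[-r, r]) `&` [set p : R * R | p.1 * p.1 + p.2 * p.2 <= r ^+ 2].
have nK p : K p <-> normc (p.1 +i* p.2) <= r.
  have -> : (normc (p.1 +i* p.2) <= r) = (p.1 * p.1 + p.2 * p.2 <= r ^+ 2).
    by rewrite -(@ler_pXn2r _ 2) ?nnegrE ?normc_ge0// sqr_normcE -!expr2.
  split => [[]//|h]; split => //.
  have h2 (a b : R) : a * a + b * b <= r ^+ 2 -> -r <= a <= r.
    move=> hab; rewrite -ler_norml -(@ler_pXn2r _ 2) ?nnegrE//.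
    by rewrite real_normK ?num_real// (le_trans _ hab)// expr2 lerDl -expr2 sqr_ge0.
  by split => /=; rewrite in_itv /=; apply: h2; [|rewrite addrC]; exact: h.
have cK : compact K.
  apply: compact_closedI.
    by apply: compact_setX; exact: segment_compact.
  rewrite (_ : [set _ | _] = (fun p : R * R => p.1 * p.1 + p.2 * p.2) @^-1` [set x | x <= r ^+ 2])//.
  apply: preimage_closed; last exact: closed_le.
  move=> p _.
  have c1 : (fun q : R * R => q.1) @ p --> (p.1 : R) by exact: cvg_fst.
  have c2 : (fun q : R * R => q.2) @ p --> (p.2 : R) by exact: cvg_snd.
  by apply: cvgD; apply: cvgM.
have K0 : K !=set0 by exists (0, 0); apply/nK; rewrite (_ : _ +i* _ = 0)// normc0.
have cG : {within K, continuous (fun p : R * R => g (p.1 +i* p.2))}.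
  apply: continuous_in_subspaceT => p /set_mem /nK hp.
  apply/cvgrPdist_lt => e e0; have [d d0 hd] := cg _ hp _ e0.
  have d2 : 0 < d / 2 by rewrite divr_gt0.
  near=> q; rewrite distrC; apply: hd.
  apply: (le_lt_trans (normc_ReIm _)); rewrite [ltRHS]splitr ltrD//= ?cReD ?cImD ?cReN ?cImN /= distrC.
  - near: q; apply: cvgr_dist_lt => //; exact: cvg_fst.
  - near: q; apply: cvgr_dist_lt => //; exact: cvg_snd.
have [p /set_mem/nK hp pmax] := compact_EVT_max K0 cK cG.
exists (p.1 +i* p.2) => // u hu.
have := pmax (Re u, Im u); case: u hu => a b hu /=; apply.
by apply/mem_set/nK.
Unshelve. all: by end_near. Qed.

End Complex.

(** * Goursat's lemma *)

Section Goursat.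
Variable R : realType.
Implicit Types (g f : R -> R) (a b c d e h k x y : R).

Definition cint g a b : R := (\int[lebesgue_measure]_(x in `[a, b]) g x)%R.

Local Notation cont g a b := {within `[a, b], continuous g}.

Let cont_int g a b : cont g a b ->
  (@lebesgue_measure R).-integrable `[a, b] (EFin \o g).
Proof. by move=> ?; apply: continuous_compact_integrable => //; exact: segment_compact. Qed.

Lemma cint_split g a b c : a <= c -> c <= b -> cont g a b ->
  cint g a b = cint g a c + cint g c b.
Proof.
move=> ac cb cg; have ig := cont_int cg.
have := @Rintegral_itvB R g (BLeft a) (BRight b) c ig.
rewrite !bnd_simp => /(_ ac cb); rewrite Rintegral_itv_obnd_cbnd /cint.
  by move=> <-; rewrite addrC subrK.
by apply: (integrableS _ _ _ ig) => //; apply: subset_itvr; rewrite bnd_simp.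
Qed.

Lemma cint_sub g f a b : cont g a b -> cont f a b ->
  cint (fun x => g x - f x) a b = cint g a b - cint f a b.
Proof. by move=> /cont_int ig /cont_int ih; rewrite /cint RintegralB. Qed.

Lemma cint_close g a b k e : a <= b -> cont g a b ->
  (forall x, a <= x <= b -> `|g x - k| <= e) ->
  `|cint g a b - k * (b - a)| <= e * (b - a).
Proof.
move=> ab cg ge.
have ck : cont (fun=> k) a b by move=> x; exact: cvg_cst.
have ce : cont (fun=> e) a b by move=> x; exact: cvg_cst.
have mab : fine (@lebesgue_measure R `[a, b]) = b - a.
  rewrite lebesgue_measure_itv/= lte_fin; case: ltP => [_ //|ba].
  by rewrite (@le_anti _ _ a b) ?subrr ?ab ?ba.
have cst z : cint (fun=> z) a b = z * (b - a).
  by rewrite /cint Rintegral_cst ?mab.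
rewrite -!cst -cint_sub // /cint.
have igk : (@lebesgue_measure R).-integrable `[a, b] (EFin \o (fun x => g x - k)).
  by apply: cont_int => x; apply: cvgB; [exact: cg|exact: cvg_cst].
apply: (le_trans (le_normr_Rintegral _ igk)) => //.
apply: le_Rintegral => //.
- exact: integrable_norm igk.
- exact: cont_int.
Qed.

Lemma nbhs_distr_lt x e : 0 < e -> \forall t \near x, `|t - x| < e.
Proof. by move=> e0; apply/nbhs_ballP; exists e => // t; rewrite /ball/= distrC. Qed.

(** Complex differentiability of [u + iv] at [x + iy] with derivative [a + ib], split into real and
    imaginary parts. It is a pointwise condition, as Goursat's argument requires: nothing is said
    about continuity of the partial derivatives. *)
Definition cauchy_riemann (u v : R -> R -> R) x y := exists a b, forall e, 0 < e ->
  exists2 d, 0 < d & forall h k, `|h| < d -> `|k| < d ->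
    `|u (x + h) (y + k) - u x y - (a * h - b * k)| <= e * (`|h| + `|k|) /\
    `|v (x + h) (y + k) - v x y - (b * h + a * k)| <= e * (`|h| + `|k|).

Lemma cauchy_riemann_continuous u v x y : cauchy_riemann u v x y ->
  {for y, continuous (u x)} /\ {for x, continuous (v^~ y)}.
Proof.
move=> [a [b /(_ 1 ltr01)[d d0 H]]].
have M0 : 0 < 1 + `|b| by rewrite ltr_pwDl.
split; apply/cvgrPdist_lt => e e0; near=> t; rewrite distrC.
- have td : `|t - y| < d by near: t; exact: nbhs_distr_lt.
  have te : `|t - y| < e / (1 + `|b|).
    by near: t; apply: nbhs_distr_lt; rewrite divr_gt0.
  have [|+ _] := H 0 (t - y) _ td; first by rewrite normr0.
  rewrite addr0 [y + _]addrC subrK mulr0 sub0r opprK normr0 add0r mul1r => h.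
  rewrite -(addrK (b * (t - y)) (u x t - u x y)) (le_lt_trans (ler_normB _ _))//.
  rewrite (le_lt_trans (lerD h (lexx _)))// normrM -[X in X + _]mul1r -mulrDl.
  by rewrite mulrC -ltr_pdivlMr.
- have td : `|t - x| < d by near: t; exact: nbhs_distr_lt.
  have te : `|t - x| < e / (1 + `|b|).
    by near: t; apply: nbhs_distr_lt; rewrite divr_gt0.
  have [|_ +] := H (t - x) 0 td; first by rewrite normr0.
  rewrite addr0 [x + _]addrC subrK mulr0 !addr0 normr0 addr0 mul1r => h.
  rewrite -(subrK (b * (t - x)) (v t y - v x y)) (le_lt_trans (ler_normD _ _))//.
  rewrite (le_lt_trans (lerD h (lexx _)))// normrM -[X in X + _]mul1r -mulrDl.
  by rewrite mulrC -ltr_pdivlMr.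
Unshelve. all: by end_near. Qed.

(** The imaginary part of the counterclockwise contour integral of [u + iv]. Opposite sides share
    one integral, so that the values at the centre cancel inside the integrand. *)
Definition rect_flux (u v : R -> R -> R) x0 x1 y0 y1 :=
  cint (fun x => v x y0 - v x y1) x0 x1 + cint (fun y => u x1 y - u x0 y) y0 y1.

Section Rect.
Variables (u v : R -> R -> R) (x0 x1 y0 y1 : R).
Hypothesis CR : forall x y, x0 <= x <= x1 -> y0 <= y <= y1 -> cauchy_riemann u v x y.
Let inx x := x0 <= x <= x1.
Let iny y := y0 <= y <= y1.

Let contu x c d : inx x -> iny c -> iny d -> cont (u x) c d.
Proof.
move=> hx /andP[hc _] /andP[_ hd]; apply: continuous_in_subspaceT => y.
move=> /set_mem /=; rewrite in_itv /= => /andP[h1 h2].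
apply: (cauchy_riemann_continuous (CR hx _)).1.
by rewrite (le_trans hc)// (le_trans _ hd).
Qed.

Let contv y c d : iny y -> inx c -> inx d -> cont (v^~ y) c d.
Proof.
move=> hy /andP[hc _] /andP[_ hd]; apply: continuous_in_subspaceT => x.
move=> /set_mem /=; rewrite in_itv /= => /andP[h1 h2].
apply: (cauchy_riemann_continuous (CR _ hy)).2.
by rewrite (le_trans hc)// (le_trans _ hd).
Qed.

Lemma rect_fluxE a b c d : inx a -> inx b -> iny c -> iny d ->
  rect_flux u v a b c d = cint (v^~ c) a b - cint (v^~ d) a b
    + (cint (u b) c d - cint (u a) c d).
Proof. by move=> *; rewrite /rect_flux !cint_sub//; do ?[exact: contu|exact: contv]. Qed.

Lemma rect_flux_split a m b c n d : a <= m <= b -> c <= n <= d ->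
  inx a -> inx b -> iny c -> iny d ->
  rect_flux u v a b c d = rect_flux u v a m c n + rect_flux u v m b c n
    + rect_flux u v a m n d + rect_flux u v m b n d.
Proof.
move=> /andP[am mb] /andP[cn nd] ha hb hc hd.
have hm : inx m.
  move: ha hb => /andP[h1 _] /andP[_ h2]; rewrite /inx.
  by rewrite (le_trans h1)// (le_trans mb).
have hn : iny n.
  move: hc hd => /andP[h1 _] /andP[_ h2]; rewrite /iny.
  by rewrite (le_trans h1)// (le_trans nd).
rewrite !rect_fluxE//.
rewrite (cint_split am mb (contv hc ha hb)) (cint_split am mb (contv hd ha hb)).
rewrite (cint_split cn nd (contu ha hc hd)) (cint_split cn nd (contu hb hc hd)).
by ring.
Qed.

(* Around [(X, Y)] the form [v dx + u dy] agrees up to [e * size] with its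
   linearisation, whose flux vanishes by the Cauchy-Riemann equations. *)
Lemma rect_flux_small X Y e : inx X -> iny Y -> 0 < e ->
  exists2 del, 0 < del & forall a b c d, inx a -> inx b -> iny c -> iny d ->
   a <= X <= b -> c <= Y <= d -> b - a < del -> d - c < del ->
   `|rect_flux u v a b c d| <= e * (b - a + (d - c)) ^+ 2.
Proof.
move=> hX hY e0; have [p [q H]] := CR hX hY.
have e2 : 0 < e / 2 by rewrite divr_gt0.
have [del del0 {}H] := H _ e2; exists del => // a b c d ha hb hc hd.
move=> /andP[aX Xb] /andP[cY Yd] bad dcd.
have ab := le_trans aX Xb; have cd := le_trans cY Yd.
pose S := b - a + (d - c).
have bnd x y : a <= x <= b -> c <= y <= d ->
   `|u x y - u X Y - (p * (x - X) - q * (y - Y))| <= e / 2 * S /\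
   `|v x y - v X Y - (q * (x - X) + p * (y - Y))| <= e / 2 * S.
  move=> /andP[ax xb] /andP[cy yd].
  have n1 : `|x - X| <= b - a by rewrite ler_norml; apply/andP; split; lra.
  have n2 : `|y - Y| <= d - c by rewrite ler_norml; apply/andP; split; lra.
  have [] := H (x - X) (y - Y) (le_lt_trans n1 bad) (le_lt_trans n2 dcd).
  rewrite ![_ + (_ - _)]addrC !subrK => h1 h2.
  by split; [apply: (le_trans h1)|apply: (le_trans h2)]; apply: ler_wpM2l; rewrite ?lerD// ltW.
have c1 : `|cint (fun x => v x c - v x d) a b - (p * (c - d)) * (b - a)| <= e * S * (b - a).
  apply: cint_close => //.
    by move=> x; apply: cvgB; apply: contv.
  move=> x hx; have [_ h1] := bnd x c hx (introT andP (conj (lexx _) cd)).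
  have [_ h2] := bnd x d hx (introT andP (conj cd (lexx _))).
  move: h1 h2; rewrite !ler_norml => /andP[? ?] /andP[? ?].
  by apply/andP; split; lra.
have c2 : `|cint (fun y => u b y - u a y) c d - (p * (b - a)) * (d - c)| <= e * S * (d - c).
  apply: cint_close => //.
    by move=> x; apply: cvgB; apply: contu.
  move=> y hy; have [h1 _] := bnd a y (introT andP (conj (lexx _) ab)) hy.
  have [h2 _] := bnd b y (introT andP (conj ab (lexx _))) hy.
  move: h1 h2; rewrite !ler_norml => /andP[? ?] /andP[? ?].
  by apply/andP; split; lra.
have -> : e * (b - a + (d - c)) ^+ 2 = e * S * (b - a) + e * S * (d - c).
  by rewrite -/S -mulrDr -/S expr2 mulrA.
rewrite /rect_flux; set A := cint _ _ _ in c1 *; set B := cint _ _ _ in c2 *.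
have -> : A + B = (A - p * (c - d) * (b - a)) + (B - p * (b - a) * (d - c)) by ring.
exact: (le_trans (ler_normD _ _) (lerD c1 c2)).
Qed.

Theorem goursat : x0 <= x1 -> y0 <= y1 -> rect_flux u v x0 x1 y0 y1 = 0.
Proof.
move=> x01 y01.
pose L n : R := (x1 - x0) / 2 ^+ n; pose H n : R := (y1 - y0) / 2 ^+ n.
pose B n (p : R * R) := rect_flux u v p.1 (p.1 + L n) p.2 (p.2 + H n).
pose ok n (p : R * R) := [/\ x0 <= p.1, p.1 + L n <= x1, y0 <= p.2 & p.2 + H n <= y1].
have p2 n : 0 < (2 : R) ^+ n by rewrite exprn_gt0.
have L0 n : 0 <= L n by rewrite divr_ge0 ?subr_ge0 ?(ltW (p2 n)).
have H0 n : 0 <= H n by rewrite divr_ge0 ?subr_ge0 ?(ltW (p2 n)).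
have LS n : L n = L n.+1 + L n.+1.
  by rewrite /L exprS; field; rewrite gt_eqF.
have HS n : H n = H n.+1 + H n.+1.
  by rewrite /H exprS; field; rewrite gt_eqF.
(* The premise [ok n p] stands under the existential so that [choice] returns a total function. The
   witness is a quarter that carries at least a fourth of the flux. *)
have step n (p : R * R) : exists q : R * R, ok n p -> [/\ ok n.+1 q,
    (p.1 <= q.1 /\ q.1 + L n.+1 <= p.1 + L n),
    (p.2 <= q.2 /\ q.2 + H n.+1 <= p.2 + H n) & `|B n p| <= 4 * `|B n.+1 q|].
  have [okp|nokp] := pselect (ok n p); last by exists p.
  case: (okp) => h1 h2 h3 h4; have hL := LS n; have hH := HS n.
  have l0 := L0 n.+1; have k0 := H0 n.+1.
  have spl := @rect_flux_split p.1 (p.1 + L n.+1) (p.1 + L n) p.2 (p.2 + H n.+1) (p.2 + H n).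
  have {spl} spl : B n p = B n.+1 p + B n.+1 (p.1 + L n.+1, p.2)
      + B n.+1 (p.1, p.2 + H n.+1) + B n.+1 (p.1 + L n.+1, p.2 + H n.+1).
    rewrite {1}/B; etransitivity; first (apply: spl; rewrite ?/inx ?/iny).
    all: try by (apply/andP; split; lra).
    by rewrite /B /= hL hH !addrA.
  suff : exists2 q : R * R, (q.1 = p.1 \/ q.1 = p.1 + L n.+1) /\
      (q.2 = p.2 \/ q.2 = p.2 + H n.+1) & `|B n p| <= 4 * `|B n.+1 q|.
    case=> q [q1 q2] hq; exists q => _; rewrite /ok; split => //.
    - by case: q1 => ->; case: q2 => ->; split; lra.
    - by case: q1 => ->; split; lra.
    - by case: q2 => ->; split; lra.
  apply: contrapT => nex.
  have small q : (q.1 = p.1 \/ q.1 = p.1 + L n.+1) /\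
      (q.2 = p.2 \/ q.2 = p.2 + H n.+1) -> 4 * `|B n.+1 q| < `|B n p|.
    by move=> hq; rewrite ltNge; apply/negP => h; apply: nex; exists q.
  have b1 := small p (conj (or_introl erefl) (or_introl erefl)).
  have b2 := small (p.1 + L n.+1, p.2) (conj (or_intror erefl) (or_introl erefl)).
  have b3 := small (p.1, p.2 + H n.+1) (conj (or_introl erefl) (or_intror erefl)).
  have b4 := small (p.1 + L n.+1, p.2 + H n.+1)
                   (conj (or_intror erefl) (or_intror erefl)).
  have : `|B n p| <= `|B n.+1 p| + `|B n.+1 (p.1 + L n.+1, p.2)|
      + `|B n.+1 (p.1, p.2 + H n.+1)| + `|B n.+1 (p.1 + L n.+1, p.2 + H n.+1)|.
    rewrite spl; do 2 (apply: (le_trans (ler_normD _ _)); apply: lerD => //).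
    exact: ler_normD.
  by lra.
have [F HF] := choice (fun np : nat * (R * R) => step np.1 np.2).
pose s := fix s n := if n is m.+1 then F (m, s m) else (x0, y0).
have oks n : ok n (s n).
  elim: n => [|n IH].
    by rewrite /ok /= /L /H !expr0 !divr1 ![_ + (_ - _)]addrC !subrK.
  by have [] := HF (n, s n) IH.
have sS n := HF (n, s n) (oks n).
have mono1 n m : (s n).1 <= (s (n + m)%N).1 /\ (s (n + m)%N).1 + L (n + m)%N <= (s n).1 + L n.
  elim: m => [|m [h1 h2]]; first by rewrite addn0; split.
  rewrite addnS; have [_ [h3 h4] _ _] := sS (n + m)%N.
  by split; [exact: (le_trans h1)|exact: (le_trans h4)].
have mono2 n m : (s n).2 <= (s (n + m)%N).2 /\ (s (n + m)%N).2 + H (n + m)%N <= (s n).2 + H n.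
  elim: m => [|m [h1 h2]]; first by rewrite addn0; split.
  rewrite addnS; have [_ _ [h3 h4] _] := sS (n + m)%N.
  by split; [exact: (le_trans h1)|exact: (le_trans h4)].
have nest (t : nat -> R) (l : nat -> R) : (forall n, 0 <= l n) ->
    (forall n m, t n <= t (n + m)%N /\ t (n + m)%N + l (n + m)%N <= t n + l n) ->
    exists X, forall n, t n <= X <= t n + l n.
  move=> l0 mono; have ub n m : t n <= t m + l m.
    case: (leqP n m) => [/subnKC <-|/ltnW/subnKC <-].
      by apply: (le_trans (mono n (m - n)%N).1); rewrite lerDl.
    by apply: (le_trans _ (mono m (n - m)%N).2); rewrite lerDl.
  have hs : has_sup (range t).
    split; first by exists (t 0%N); exists 0%N.
    by exists (t 0%N + l 0%N) => _ [n _ <-].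
  exists (sup (range t)) => n; apply/andP; split.
    by apply: ub_le_sup; [exact: hs.2|exists n].
  by apply: ge_sup; [exact: hs.1|move=> _ [m _ <-]].
have [X hX] := nest (fun n => (s n).1) L L0 mono1.
have [Y hY] := nest (fun n => (s n).2) H H0 mono2.
have iX : inx X.
  by move: (hX 0%N); rewrite /= /L expr0 divr1 [x0 + _]addrC subrK.
have iY : iny Y.
  by move: (hY 0%N); rewrite /= /H expr0 divr1 [y0 + _]addrC subrK.
have Bn n : `|rect_flux u v x0 x1 y0 y1| <= 4 ^+ n * `|B n (s n)|.
  elim: n => [|n IH].
    by rewrite expr0 mul1r /B /= /L /H !expr0 !divr1 ![_ + (_ - _)]addrC !subrK.
  apply: (le_trans IH); rewrite exprSr -mulrA ler_wpM2l ?exprn_ge0//.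
  by have [] := sS n.
apply/eqP; rewrite -normr_le0.
pose W := x1 - x0 + (y1 - y0).
have W0 : 0 <= W by rewrite addr_ge0 ?subr_ge0.
suff key e : 0 < e -> `|rect_flux u v x0 x1 y0 y1| <= e * W ^+ 2.
  apply/ler_addgt0Pr => e e0; rewrite add0r.
  apply: (le_trans (key (e / (1 + W ^+ 2)) _)).
    by rewrite divr_gt0// ltr_pwDl ?sqr_ge0.
  rewrite mulrAC ler_pdivrMr ?ltr_pwDl ?sqr_ge0//.
  by rewrite ler_wpM2l ?lerDr// ltW.
move=> e0; have [del del0 hdel] := rect_flux_small iX iY e0.
have [n hn] : exists n, W < del * 2 ^+ n.
  by exists (Num.bound (W / del)); rewrite mulrC -ltr_pdivrMr// upper_nthrootP.
apply: (le_trans (Bn n)).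
have [q1 q2 q3 q4] := oks n; have l0 := L0 n; have h0 := H0 n.
have LH : L n + H n < del by rewrite /L /H -mulrDl ltr_pdivrMr.
have := hdel (s n).1 ((s n).1 + L n) (s n).2 ((s n).2 + H n).
rewrite /inx /iny hX hY -/(B n (s n)) ![_ + L n]addrC ![_ + H n]addrC !addrK.
move=> hB; apply: (@le_trans _ _ (4 ^+ n * (e * (L n + H n) ^+ 2))).
  apply: ler_wpM2l; first exact: exprn_ge0.
  by apply: hB => //; (try (apply/andP; split)); lra.
have -> : L n + H n = W / 2 ^+ n by rewrite /L /H -mulrDl.
(* The loss of a factor 4 at each bisection is exactly compensated by the quadratic bound in the
   size of the rectangle. *)
have -> : (4 : R) ^+ n = (2 ^+ n) ^+ 2.
  by rewrite -exprM mulnC exprM; congr (_ ^+ n); ring.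
by rewrite le_eqVlt; apply/orP; left; apply/eqP; field; rewrite gt_eqF.
Qed.

End Rect.
End Goursat.

(** * The mean value property *)

Section Polar.
Variable R : realType.
Implicit Types (z : R[i]) (x y h k e d : R).

Lemma cint_le (g : R -> R) a b k : a <= b -> {within `[a, b], continuous g} ->
  (forall x, a <= x <= b -> g x <= k) -> cint g a b <= k * (b - a).
Proof.
move=> ab cg gk.
have ck : {within `[a, b], continuous (fun=> k : R)} by move=> x; exact: cvg_cst.
have k0 x : a <= x <= b -> `|k - k| <= 0 by rewrite subrr normr0.
have := cint_close ab ck k0; rewrite mul0r normr_le0 subr_eq0 => /eqP <-.
apply: le_Rintegral => //.
- by apply: continuous_compact_integrable => //; exact: segment_compact.
- by apply: continuous_compact_integrable => //; exact: segment_compact.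
Qed.

Lemma is_derive_eps (f : R -> R) x l : is_derive x 1 f l ->
  forall e, 0 < e -> exists2 d, 0 < d & forall h, `|h| < d ->
    `|f (x + h) - f x - l * h| <= e * `|h|.
Proof.
move=> [/cvg_ex[/= l' hl'] hl] e e0.
have El : l' = l by rewrite -hl /derive; apply/esym; exact: cvg_lim hl'.
rewrite {}El in hl'; move/cvgrPdist_lt : hl' => /(_ e e0)/nbhs_ballP[d /= d0 hd].
exists d => // h hh; have [->|h0] := eqVneq h 0.
  by rewrite addr0 mulr0 subr0 subrr normr0 mulr0.
have := hd h; rewrite /ball /= sub0r normrN => /(_ hh h0).
set q := _ *: _ => hq; have -> : f (x + h) - f x - l * h = (q - l) * h.
  by rewrite /q /= [h *: 1]mulr1 [_ *: _]mulrC mulrBl divfK// [h + x]addrC.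
by rewrite normrM ler_wpM2r// distrC ltW.
Qed.

Definition cexp x y : R[i] := (expR x)%:C * (cos y +i* sin y).

Lemma cexpD x y h k : cexp (x + h) (y + k) = cexp x y * cexp h k.
Proof.
rewrite /cexp expRD cosD sinD; apply/eqP; rewrite eq_complex /=.
by apply/andP; split; apply/eqP; ring.
Qed.

Lemma normc_cexp x y : normc (cexp x y) = expR x.
Proof.
by rewrite normcM normcR ger0_norm ?expR_ge0//= cos2Dsin2 sqrtr1 mulr1.
Qed.

Lemma cexp_near0 e : 0 < e -> exists2 d, 0 < d & forall h k, `|h| < d -> `|k| < d ->
  normc (cexp h k - 1 - (h +i* k)) <= e * (`|h| + `|k|).
Proof.
(* The four errors [A1] to [A4] have coefficients 1, 2, 3 and 2; the last three concern [|k|] and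
   add up to 7. The bound [e1 <= 1] gives [|h| < 1] and the rough estimates of [expR h]. *)
move=> e0; pose e1 := Num.min 1 (e / 7).
have e10 : 0 < e1 by rewrite lt_min ltr01 divr_gt0.
have [le1 le7] : e1 <= 1 /\ e1 <= e / 7 by split; rewrite ge_min lexx ?orbT.
clearbody e1.
have [d1 d10 H1] := is_derive_eps (is_derive_expR (0 : R)) e10.
have [d2 d20 H2] := is_derive_eps (is_derive_cos (0 : R)) e10.
have [d3 d30 H3] := is_derive_eps (is_derive_sin (0 : R)) e10.
exists (Num.min (Num.min d1 d2) (Num.min d3 e1)).
  by rewrite !lt_min d10 d20 d30 e10.
move=> h k; rewrite !lt_min => /andP[/andP[h1 h2] /andP[h3 h4]].
move=> /andP[/andP[k1 k2] /andP[k3 k4]].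
have := H1 h h1; have := H2 k k2; have := H3 k k3.
rewrite !add0r sin0 cos0 expR0 oppr0 mul0r !subr0 !mul1r addr0 => Hs Hc He.
have cos1 : `|cos k| <= 1 by rewrite ler_norml cos_geN1 cos_le1.
have nh := normr_ge0 h; have nk := normr_ge0 k.
have ex2 : `|expR h - 1| <= 2 * `|h|.
  rewrite -(subrK h (expR h - 1)); apply: (le_trans (ler_normD _ _)); nra.
have ex3 : `|expR h| <= 3.
  rewrite -(subrK 1 (expR h)); apply: (le_trans (ler_normD _ _)); rewrite normr1; nra.
have h12 : `|1 + h| <= 2 by apply: (le_trans (ler_normD _ _)); rewrite normr1; lra.
apply: (le_trans (normc_ReIm _)); rewrite /cexp /=.
have -> : expR h * cos k - 0 * sin k + - 1 + - h
  = (expR h - 1 - h) * cos k + (1 + h) * (cos k - 1) by ring.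
have -> : expR h * sin k + 0 * cos k + - 0 + - k
  = expR h * (sin k - k) + (expR h - 1) * k by ring.
have A1 : `|(expR h - 1 - h) * cos k| <= e1 * `|h|.
  by rewrite normrM; apply: (le_trans _ He); rewrite ler_piMr.
have A2 : `|(1 + h) * (cos k - 1)| <= 2 * (e1 * `|k|) by rewrite normrM ler_pM.
have A3 : `|expR h * (sin k - k)| <= 3 * (e1 * `|k|) by rewrite normrM ler_pM.
have A4 : `|(expR h - 1) * k| <= 2 * (e1 * `|k|).
  by rewrite normrM; apply: (le_trans (ler_wpM2r nk ex2)); nra.
apply: (le_trans (lerD (ler_normD _ _) (ler_normD _ _))).
have : e1 * (`|h| + `|k|) <= e / 7 * (`|h| + `|k|) by rewrite ler_wpM2r// addr_ge0.
have := mulr_ge0 (ltW e10) nh; have := mulr_ge0 (ltW e10) nk.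
lra.
Qed.

(** The chain rule, with derivative [D * E]. The outer error is [e1] times [|dE| <= 2 |E| N], the
    inner one is [|D| |E| e2 N], and each is at most [e / 2 * N]; the summand 1 in the denominators
    covers vanishing [D]. *)
Lemma cauchy_riemann_polar (f : R[i] -> R[i]) x y :
  derivable (f : R[i]^o -> R[i]^o) (cexp x y) 1 ->
  cauchy_riemann (fun x y => Re (f (cexp x y))) (fun x y => Im (f (cexp x y))) x y.
Proof.
move=> /derivable_normcP[D HD]; set E := cexp x y.
exists (Re (D * E)), (Im (D * E)) => e e0.
have nD := normc_ge0 D; have nE := normc_ge0 E.
pose e2 := Num.min 1 (e / 2 / (1 + normc D * normc E)).
have k0 : 0 < 1 + normc D * normc E by rewrite ltr_pwDl// mulr_ge0.
have e20 : 0 < e2 by rewrite lt_min ltr01 !divr_gt0.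
pose e1 := e / 2 / (1 + 2 * normc E).
have k1 : 0 < 1 + 2 * normc E by rewrite ltr_pwDl// mulr_ge0.
have e10 : 0 < e1 by rewrite !divr_gt0.
have [d1 d10 H1] := HD _ e10; have [d2 d20 H2] := cexp_near0 e20.
pose d3 := d1 / 2 / (1 + 2 * normc E).
have d30 : 0 < d3 by rewrite !divr_gt0.
exists (Num.min d2 d3); first by rewrite lt_min d20.
move=> h k; rewrite !lt_min => /andP[h2 h3] /andP[k2 k3].
pose N := `|h| + `|k|; have N0 : 0 <= N by rewrite addr_ge0.
have := H2 h k h2 k2; rewrite -/N => Hx.
have nhk : normc (h +i* k) <= N by exact: normc_ReIm.
have [le1 le2] : e2 <= 1 /\ e2 <= e / 2 / (1 + normc D * normc E).
  by split; rewrite ge_min lexx ?orbT.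
set dE := cexp (x + h) (y + k) - E.
have dEE : dE - E * (h +i* k) = E * (cexp h k - 1 - (h +i* k)).
  by rewrite /dE cexpD -/E; ring.
have ndEE : normc (dE - E * (h +i* k)) <= normc E * (e2 * N).
  by rewrite dEE normcM ler_wpM2l.
have ndE : normc dE <= 2 * normc E * N.
  rewrite -(subrK (E * (h +i* k)) dE); apply: (le_trans (le_normcD _ _)).
  rewrite [X in _ + X <= _]normcM.
  have := ler_wpM2l nE nhk; have := mulr_ge0 nE N0; have : e2 * N <= 1 * N by exact: ler_wpM2r.
  move=> q1 q2; have := ler_wpM2l nE q1; lra.
have ndE1 : normc dE < d1.
  apply: (le_lt_trans ndE).
  have : N < 2 * d3 by rewrite /N mulr2n mulrDl !mul1r ltrD.
  have -> : d1 = (1 + 2 * normc E) * (2 * d3) by rewrite /d3; field; rewrite gt_eqF.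
  move=> q; apply: (@le_lt_trans _ _ ((1 + 2 * normc E) * N)); first by rewrite ler_wpM2r// lerDr.
  by rewrite ltr_pM2l.
have := H1 dE ndE1; have -> : E + dE = cexp (x + h) (y + k) by rewrite /dE addrC subrK.
set df := f _ - f _ => Hf.
have main : normc (df - D * E * (h +i* k)) <= e * N.
  have -> : df - D * E * (h +i* k) =
    (df - D * dE) + D * (dE - E * (h +i* k)) by ring.
  apply: (le_trans (le_normcD _ _)); rewrite [X in _ + X <= _]normcM.
  apply: (@le_trans _ _ (e / 2 * N + e / 2 * N)); last by rewrite -mulrDl -splitr.
  apply: lerD.
    apply: (le_trans Hf); apply: (le_trans (ler_wpM2l (ltW e10) ndE)).
    rewrite mulrA ler_wpM2r// /e1 mulrAC ler_pdivrMr// ler_wpM2l ?lerDr//.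
    by rewrite divr_ge0// ltW.
  apply: (le_trans (ler_wpM2l nD ndEE)); rewrite !mulrA ler_wpM2r//.
  apply: (@le_trans _ _ (normc D * normc E * (e / 2 / (1 + normc D * normc E)))).
    by rewrite ler_wpM2l// mulr_ge0.
  rewrite mulrA ler_pdivrMr// mulrC ler_wpM2l ?lerDr//.
  by rewrite divr_ge0// ltW.
split.
- apply: le_trans main; apply: le_trans (normr_Re _).
  by rewrite (cReD df) cReN (cReM (D * E)) (cReD _ (- f E)) cReN.
- apply: le_trans main; apply: le_trans (normr_Im _).
  by rewrite (cImD df) cImN (cImM (D * E)) (cImD _ (- f E)) cImN [X in _ - X]addrC.
Qed.

(* The mean of [Re f] over the circle of radius [rho] does not depend on [rho],
   so it is [Re (f 0)]. *)
Lemma no_strict_max (f : R[i] -> R[i]) rho0 e : 0 < rho0 -> 0 < e ->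
  {for 0, continuous (f : R[i]^o -> R[i]^o)} ->
  (forall z, 0 < normc z < rho0 -> derivable (f : R[i]^o -> R[i]^o) z 1) ->
  ~ (forall z, normc z < rho0 -> Re (f z) <= Re (f 0) - e * normc z ^+ 2).
Proof.
move=> r0 e0 /continuous_normcP cf df fmax.
pose rho := rho0 / 2; have rho_gt0 : 0 < rho by rewrite divr_gt0.
have rho_lt : rho < rho0 by rewrite /rho; lra.
(* Half of the assumed drop on the circle of radius [rho]: on the circle of radius [s] the function
   stays within [eta] of its central value, so the two means cannot agree. *)
pose eta := e * rho ^+ 2 / 2.
have eta0 : 0 < eta by rewrite divr_gt0// mulr_gt0// exprn_gt0.
have [d d0 hd] := cf _ eta0.
pose s := Num.min rho (d / 2).
have s0 : 0 < s by rewrite lt_min rho_gt0 divr_gt0.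
have sd : s < d by rewrite gt_min; apply/orP; right; lra.
have srho : s <= rho by rewrite ge_min lexx.
pose u x y := Re (f (cexp x y)); pose v x y := Im (f (cexp x y)).
pose p2 : R := pi *+ 2.
have p20 : 0 < p2 by rewrite pmulrn_rgt0// pi_gt0.
have CR x y : ln s <= x <= ln rho -> 0 <= y <= p2 -> cauchy_riemann u v x y.
  move=> /andP[_ xr] _; apply/cauchy_riemann_polar/df; rewrite normc_cexp expR_gt0 /=.
  by rewrite (le_lt_trans _ rho_lt)// -[leRHS]lnK ?posrE// ler_expR.
have ls : ln s <= ln rho by rewrite ler_ln ?posrE.
have cu x : ln s <= x <= ln rho -> {within `[0, p2], continuous (u x)}.
  move=> hx; apply: continuous_in_subspaceT => y /set_mem /=; rewrite in_itv /= => hy.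
  exact: (cauchy_riemann_continuous (CR _ _ hx hy)).1.
have := goursat CR ls (ltW p20); rewrite /rect_flux.
(* The horizontal sides cancel by [2 pi]-periodicity; the vertical ones are the integrals of [Re f]
   over the two circles. *)
have -> : (fun x => v x 0 - v x p2) = (fun=> 0).
  apply/funext => x; rewrite /v /cexp /p2 cos2pi sin2pi cos0 sin0 subrr//.
have -> : cint (fun=> 0 : R) (ln s) (ln rho) = 0.
  by rewrite /cint Rintegral_cst// mul0r.
have hs : ln s <= ln s <= ln rho by rewrite lexx.
have hr : ln s <= ln rho <= ln rho by rewrite lexx ls.
rewrite add0r cint_sub; [|exact: cu|exact: cu].
have b1 : cint (u (ln rho)) 0 p2 <= (Re (f 0) - e * rho ^+ 2) * (p2 - 0).
  apply: cint_le => //; [exact: ltW|exact: cu|move=> y _].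
  have := fmax (cexp (ln rho) y).
  by rewrite normc_cexp lnK ?posrE//; apply.
have b2 : `|cint (u (ln s)) 0 p2 - Re (f 0) * (p2 - 0)| <= eta * (p2 - 0).
  apply: cint_close => //; [exact: ltW|exact: cu|move=> y _].
  rewrite -cReN -cReD; apply: (le_trans (normr_Re _)); apply: ltW; apply: hd.
  by rewrite subr0 normc_cexp lnK.
move: b1 b2; rewrite subr0 ler_norml => b1 /andP[b2 _] /eqP; rewrite subr_eq0 => /eqP E.
have etaE : e * rho ^+ 2 = 2 * eta by rewrite /eta; field.
have ep : 0 < eta * p2 by rewrite mulr_gt0.
move: b1 b2 ep; rewrite etaE mulrBl -mulrA -E.
move: (cint _ _ _) (Re _ * _) (eta * p2) => I A B; clear => *; lra.
Qed.

End Polar.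

(** * The Schwarz lemma *)

Section Schwarz.
Variable R : realType.

(* At an interior maximum [c] of [|g| + eps |z|^2], subtracting the harmonic part
   of [eps |z|^2] turns [g], suitably rotated, into a function whose real part
   has a strict quadratic maximum at [c]. *)
Lemma max_modulus_boundary (g : R[i] -> R[i]) (r eps : R) : 0 < r -> 0 < eps ->
  (forall z, normc z <= r -> {for z, continuous (g : R[i]^o -> R[i]^o)}) ->
  (forall z, z != 0 -> normc z <= r -> derivable (g : R[i]^o -> R[i]^o) z 1) ->
  exists2 c, normc c = r & forall z, normc z <= r ->
    normc (g z) + eps * normc z ^+ 2 <= normc (g c) + eps * normc c ^+ 2.
Proof.
move=> r0 e0 cg dg.
pose psi z := normc (g z) + eps * normc z ^+ 2.
have [c cr cmax] : exists2 c, normc c <= r & forall z, normc z <= r -> psi z <= psi c.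
  apply: (closed_disk_max (ltW r0)) => z zr e ee0.
  have /continuous_normcP cz := cg z zr.
  have e2 : 0 < e / 2 by rewrite divr_gt0.
  have [d d0 hd] := cz _ e2.
  have M0 : 0 < eps * (2 * normc z + 1) by rewrite mulr_gt0// ltr_wpDl// mulr_ge0// normc_ge0.
  exists (Num.min d (Num.min 1 (e / 2 / (eps * (2 * normc z + 1))))).
    by rewrite !lt_min d0 ltr01 divr_gt0.
  move=> u; rewrite !lt_min => /andP[/hd h1 /andP[h2]].
  rewrite ltr_pdivlMr// => h3.
  have n1 := ler_normcB (g u) (g z); have n2 := ler_normcB (g z) (g u).
  rewrite [normc (g z - _)]normcB in n2.
  have n3 := ler_normcB u z; have n4 := ler_normcB z u.
  rewrite [normc (z - _)]normcB in n4.
  have := normc_ge0 u; have := normc_ge0 z; move: n3 n4 h2 h3; set a := normc u.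
  set b := normc z; set t := normc (u - z) => n3 n4 h2 h3 b0 a0.
  have q : `|a ^+ 2 - b ^+ 2| <= t * (2 * b + 1).
    rewrite subr_sqr normrM; apply: ler_pM => //.
      by rewrite ler_norml; apply/andP; split; lra.
    by rewrite ger0_norm ?addr_ge0//; lra.
  have q2 : `|eps * (a ^+ 2 - b ^+ 2)| < e / 2.
    rewrite normrM gtr0_norm//; apply: le_lt_trans h3.
    by rewrite mulrCA ler_wpM2l// ltW.
  rewrite /psi -/a -/b; move: q2; rewrite !ltr_norml => /andP[? ?].
  by apply/andP; split; lra.
have [cE|/eqP cne] := eqVneq (normc c) r; first by exists c.
exfalso; have {cr cne}cr : normc c < r by rewrite lt_neqAle cr andbT; apply/eqP.
have [ub [ub1 ubE]] : exists ub : R[i], normc ub = 1 /\ ub * g c = (normc (g c))%:C.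
  have [g0|g0] := eqVneq (g c) 0.
    by exists 1; rewrite normc1 g0 mulr0 normc0.
  have ng : normc (g c) != 0 by rewrite normc_eq0.
  exists ((normc (g c))%:C / g c); split; last by rewrite divfK.
  by rewrite normcM normcV normcR ger0_norm ?normc_ge0// divff.
(* The function [g] is only continuous at the origin. A disk about [c] must therefore avoid the
   origin, unless [c] is the origin and the exceptional point is the centre. *)
pose rho0 := if c == 0 then r else Num.min (r - normc c) (normc c).
have rho00 : 0 < rho0.
  by rewrite /rho0; case: ifPn => // c0; rewrite lt_min subr_gt0 cr normc_gt0.
have inr z : normc z < rho0 -> normc (c + z) <= r.
  rewrite /rho0; case: ifPn => [/eqP -> |_]; first by rewrite add0r => /ltW.
  rewrite lt_min => /andP[h _]; apply: (le_trans (le_normcD _ _)); lra.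
have ne0 z : 0 < normc z < rho0 -> c + z != 0.
  rewrite /rho0 => /andP[z0]; case: ifPn => [/eqP -> _|_]; first by rewrite add0r -normc_gt0.
  rewrite lt_min => /andP[_ h]; apply: contraTN h => /eqP h.
  by rewrite (_ : z = - c) ?normcN ?ltxx//; apply/eqP; rewrite -addr_eq0 addrC h.
(* The added term has as real part the cross term of [eps * |c + z|^2]; what remains of the square,
   [eps * |z|^2], becomes the strict decrease. *)
pose f (z : R[i]) : R[i] := ub * g (c + z) + (2 * eps)%:C * c^* * z.
apply: (@no_strict_max _ f rho0 eps rho00 e0).
- have /continuous_normcP cc := cg _ (ltW cr).
  apply/continuous_normcP => e ee0; have e2 : 0 < e / 2 by rewrite divr_gt0.
  have [d d0 hd] := cc _ e2; pose k := (2 * eps)%:C * c^*.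
  have k0 : 0 < 1 + normc k by rewrite ltr_pwDl// normc_ge0.
  exists (Num.min d (e / 2 / (1 + normc k))); first by rewrite lt_min d0 divr_gt0.
  move=> u; rewrite subr0 lt_min ltr_pdivlMr// => /andP[h1 h2].
  rewrite /f -/k addr0 mulr0 addr0 addrAC -mulrBr.
  apply: (le_lt_trans (le_normcD _ _)); rewrite (normcM ub) (normcM k) ub1 mul1r [ltRHS]splitr.
  apply: ltrD; first by apply: hd; rewrite addrAC subrr add0r.
  apply: le_lt_trans h2; rewrite mulrC; apply: ler_wpM2l; first exact: normc_ge0.
  by rewrite lerDr.
- move=> z hz; have dz := dg _ (ne0 _ hz) (inr _ (proj2 (andP hz))).
  apply: (@derivableD _ R[i]^o R[i]^o (fun z => ub * g (c + z))
     (fun z => (2 * eps)%:C * c^* * z)).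
    apply: (@derivableM _ R[i]^o (cst ub) (fun z => g (c + z))).
      exact: derivable_cst.
    exact: derivable_shift.
  apply: (@derivableM _ R[i]^o (cst _) id); first exact: derivable_cst.
  exact: derivable_id.
- move=> z hz; have := cmax _ (inr _ hz); rewrite /psi /f addr0 mulr0 addr0 ubE /= => h.
  rewrite cReD; have : Re (ub * g (c + z)) <= normc (g (c + z)).
    by apply: (le_trans (ler_norm _)); apply: (le_trans (normr_Re _)); rewrite normcM ub1 mul1r.
  have E2 : normc (c + z) ^+ 2 = normc c ^+ 2 + normc z ^+ 2 + 2 * Re (c^* * z).
    by rewrite !sqr_normcE cReD cImD cReM; case: (c) => a b /=; ring.
  have -> : Re ((2 * eps)%:C * c^* * z) = 2 * eps * Re (c^* * z) by rewrite -mulrA cReZ.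
  by rewrite E2 in h; lra.
Qed.

Lemma schwarz_lemma (w : R[i] -> R[i]) z : schwarz w -> normc z < 1 ->
  normc (w z) <= normc z.
Proof.
move=> [hw w0 w1] z1; rewrite leNgt; apply/negP => hlt.
have z0 : 0 < normc z.
  by rewrite lt_neqAle normc_ge0 andbT eq_sym; apply: contraTneq hlt => /eq0_normc ->;
     rewrite w0 ltxx.
have /derivable_normcP[D HD] := (hw 0 (eq_ind_r (fun x => x < 1) ltr01 (normc0 R))).
(* With [D] the derivative at the origin this is continuous there, which is all that the maximum
   principle above asks at that point. *)
pose g (z : R[i]) := if z == 0 then D else w z / z.
(* If [m > 1], take [r] so close to 1 that [|w c| / r < (1 + m) / 2] on [|c| = r]. With
   [eps = (m - 1) / 4] the perturbed modulus on the boundary stays below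
   [(1 + m) / 2 + (m - 1) / 4 < m], contradicting its value at [z]. *)
pose m := normc (w z) / normc z.
have m1 : 1 < m by rewrite ltr_pdivlMr// mul1r.
pose r := Num.max (normc z) (2 / (1 + m)).
have r1 : r < 1 by rewrite gt_max z1 ltr_pdivrMr; lra.
have r0 : 0 < r by rewrite lt_max z0.
have zr : normc z <= r by rewrite le_max lexx.
have rm : r^-1 <= (1 + m) / 2.
  rewrite -[X in _ <= X]invrK lef_pV2 ?posrE// ?invr_gt0; last lra.
  by rewrite invfM invrK mulrC le_max lexx orbT.
pose eps := (m - 1) / 4.
have e0 : 0 < eps by rewrite divr_gt0// subr_gt0.
have gE u : u != 0 -> {near (u : R[i]^o), (fun z => w z / z) =1 g}.
  move=> u0; apply/nbhs_normcP; exists (normc u); first by rewrite normc_gt0.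
  move=> v hv; rewrite /g; case: ifPn => // /eqP v0.
  by move: hv; rewrite v0 sub0r normcN ltxx.
have dg u : u != 0 -> normc u <= r -> derivable (g : R[i]^o -> R[i]^o) u 1.
  move=> u0 ur; apply: (@near_eq_derivable _ R[i]^o R[i]^o (fun z => w z / z) g u 1 (gE _ u0)).
  apply: (@derivableM _ R[i]^o w (fun z => z^-1)).
    by apply: hw; exact: le_lt_trans r1.
  by apply: (@derivableV _ R[i]^o id) => //; exact: derivable_id.
have cg u : normc u <= r -> {for u, continuous (g : R[i]^o -> R[i]^o)}.
  move=> ur; have [->|u0] := eqVneq u 0; last first.
    exact/derivable_continuous_normc/dg.
  apply/continuous_normcP => e ee0; have e2 : 0 < e / 2 by rewrite divr_gt0.
  have [d d0 hd] := HD _ e2; exists d => // v; rewrite subr0 => hv.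
  rewrite /g eqxx; case: ifPn => v0; first by rewrite subrr normc0.
  have := hd v hv; rewrite add0r w0 subr0 => h.
  have nv : 0 < normc v by rewrite normc_gt0.
  have -> : w v / v - D = (w v - D * v) / v by rewrite mulrBl mulfK.
  rewrite normcM normcV ltr_pdivrMr//; apply: (le_lt_trans h).
  by rewrite ltr_pM2r//; lra.
have [c cr /(_ z zr)] := max_modulus_boundary r0 e0 cg dg.
have c0 : c != 0 by rewrite -normc_gt0 cr.
rewrite /g (negbTE c0) -normc_eq0 gt_eqF// !normcM !normcV -/m cr leNgt => /negP; apply.
have wc := w1 c (eq_ind_r (fun x => x < 1) r1 cr).
have : normc (w c) / r < (1 + m) / 2.
  by apply: lt_le_trans rm; rewrite gtr_pMl ?invr_gt0.
have : r ^+ 2 <= 1 by rewrite expr_le1// ltW.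
have : 0 <= normc z ^+ 2 by rewrite sqr_ge0.
rewrite /eps; nra.
Qed.

End Schwarz.

(** * Positive kernels *)

Section Kernels.
Variable R : realType.
Implicit Types (b c : nat -> R) (z : R[i]) (e s : R).

Definition psum b M z : R[i] := \sum_(1 <= n < M) (b n)%:C * z ^+ n.

Lemma prim_root_exists N : (0 < N)%N -> exists z : R[i], N.-primitive_root z.
Proof.
pose p : {poly R[i]} := 'X^N - 1; have [r Dp] := closed_field_poly_normal p.
move=> N0; rewrite (monicP _) ?monicXnsubC // scale1r in Dp.
have rn1 : all N.-unity_root r by apply/allP => z; rewrite -root_prod_XsubC -Dp.
have sz_r : (N < (size r).+1)%N by rewrite -(size_prod_XsubC r id) -Dp size_XnsubC.
have [|z] := hasP (cyclic.has_prim_root N0 rn1 _ sz_r); last by exists z.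
by rewrite -separable_prod_XsubC -Dp separable_Xn_sub_1 // pnatr_eq0 -lt0n.
Qed.

Lemma prim_root_normc N z : (0 < N)%N -> N.-primitive_root z -> normc z = 1.
Proof.
move=> N0 /prim_expr_order hz; apply/eqP; rewrite -(pexpr_eq1 N0) ?normc_ge0//.
by rewrite -normcX hz normc1.
Qed.

Lemma sum_prim_root N z j : N.-primitive_root z ->
  \sum_(k < N) (z ^+ k) ^+ j = if (N %| j)%N then N%:R else 0.
Proof.
move=> hz; under eq_bigr do rewrite -exprM mulnC exprM.
rewrite (prim_order_dvd hz); case: eqVneq => [->|h].
  by under eq_bigr do rewrite expr1n; rewrite sumr_const card_ord.
have : z ^+ j - 1 != 0 by rewrite subr_eq0.
move=> /mulfI; apply; rewrite mulr0 -subrX1 -exprM mulnC exprM.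
by rewrite (prim_expr_order hz) expr1n subrr.
Qed.

(** Discrete orthogonality of the sines. The condition [n + m < N] excludes aliasing: [N] divides
    neither [n + m] nor a nonzero [n - m]. The conjugate of the [m]-th power is written as the power
    [N - m], which keeps exponents natural. *)
Lemma sum_Im_prim_root N z n m : N.-primitive_root z -> (0 < n)%N -> (n + m < N)%N ->
  \sum_(k < N) Im ((z ^+ k) ^+ n) * Im ((z ^+ k) ^+ m)
    = if n == m then N%:R / 2 else 0.
Proof.
move=> hz n0 nm; have N0 : (0 < N)%N by exact: leq_ltn_trans nm.
have mN : (m <= N)%N by apply: ltnW; apply: leq_ltn_trans nm; exact: leq_addl.
have nz k : normc (z ^+ k) = 1 by rewrite normcX (prim_root_normc N0 hz) expr1n.
have E k : Im ((z ^+ k) ^+ n) * Im ((z ^+ k) ^+ m) =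
    (Re ((z ^+ k) ^+ (n + (N - m))) - Re ((z ^+ k) ^+ (n + m))) / 2.
  have -> : (z ^+ k) ^+ (n + (N - m)) = (z ^+ k) ^+ n * ((z ^+ k) ^+ m)^*%C.
    rewrite exprD; congr (_ * _); rewrite -invc_normc1; last by rewrite normcX nz expr1n.
    have zm : (z ^+ k) ^+ m != 0 by rewrite -normc_gt0 normcX nz expr1n.
    apply: (mulfI zm); rewrite divff// -exprD subnKC// -exprM mulnC exprM.
    by rewrite (prim_expr_order hz) expr1n.
  rewrite exprD !cReM; case: ((z ^+ k) ^+ n) => a b; case: ((z ^+ k) ^+ m) => a' b' /=.
  by field.
under eq_bigr do rewrite E.
rewrite -mulr_suml sumrB -!cRe_sum !(sum_prim_root _ hz).
have -> : (N %| n + m)%N = false.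
  by apply/negbTE; rewrite gtnNdvd// addn_gt0 n0.
have -> : (N %| n + (N - m))%N = (n == m).
  apply/idP/eqP => [|->]; last by rewrite subnKC.
  case: (ltngtP n m) => // h.
    rewrite gtnNdvd//; first by rewrite addn_gt0 n0.
    by rewrite addnBA// ltn_subLR ?ltn_add2r// (leq_trans mN)// leq_addl.
  rewrite (_ : (n + (N - m) = N + (n - m))%N); last first.
    by rewrite !addnBA// 1?ltnW// addnC.
  rewrite dvdn_addr// gtnNdvd ?subn_gt0//.
  by apply: leq_ltn_trans nm; apply: leq_trans (leq_subr _ _) (leq_addr _ _).
have ReN : Re (N%:R : R[i]) = N%:R.
  by elim: (N) => // k IH; rewrite -natr1 cReD IH natr1.
by case: eqP; rewrite ?ReN /= !subr0 ?mul0r.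
Qed.

Lemma Im_psum b M z : Im (psum b M z) = \sum_(1 <= n < M) b n * Im (z ^+ n).
Proof. by rewrite cIm_sum; apply: eq_bigr => n _; rewrite cImZ. Qed.

Lemma psum_conj b M z : psum b M z^*%C = (psum b M z)^*%C.
Proof.
rewrite rmorph_sum; apply: eq_bigr => n _.
by rewrite rmorphM rmorphXn; congr (_ * _); rewrite /= oppr0.
Qed.

Lemma psum_real b M z : Im z = 0 -> Im (psum b M z) = 0.
Proof.
move=> z0; have : psum b M z^*%C = psum b M z.
  by congr psum; case: z z0 => x y /= ->; rewrite oppr0.
by rewrite psum_conj; case: psum => x y [] /eqP; rewrite eqNr => /eqP.
Qed.

(* Average of [Im b * Im c] over the roots of unity of a large order. *)
Lemma kernel_poly_ge0 b c M :
  (forall z, normc z = 1 -> 0 <= Im (psum b M z) * Im z) ->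
  (forall z, normc z = 1 -> 0 <= Im (psum c M z) * Im z) ->
  0 <= \sum_(1 <= n < M) b n * c n.
Proof.
move=> hb hc; pose N := (M + M).+1; have [z hz] := prim_root_exists (ltn0Sn (M + M)).
have nz k : normc (z ^+ k) = 1.
  by rewrite normcX (prim_root_normc _ hz)// expr1n.
have : 0 <= \sum_(k < N) Im (psum b M (z ^+ k)) * Im (psum c M (z ^+ k)).
  apply: sumr_ge0 => k _; have [z0|z0] := eqVneq (Im (z ^+ k)) 0.
    by rewrite psum_real ?mul0r.
  rewrite -(pmulr_lge0 _ (_ : 0 < Im (z ^+ k) ^+ 2)); last by rewrite exprn_even_gt0.
  rewrite expr2 mulrACA; apply: mulr_ge0; [exact/hb/nz|exact/hc/nz].
have -> : \sum_(k < N) Im (psum b M (z ^+ k)) * Im (psum c M (z ^+ k)) =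
    N%:R / 2 * \sum_(1 <= n < M) b n * c n.
  transitivity (\sum_(1 <= n < M) \sum_(1 <= m < M) \sum_(k < N)
      (b n * Im ((z ^+ k) ^+ n)) * (c m * Im ((z ^+ k) ^+ m))).
    under eq_bigr do rewrite !Im_psum big_distrlr /=.
    rewrite exchange_big /=; apply: eq_bigr => n _.
    by rewrite exchange_big.
  rewrite mulr_sumr !big_nat; apply: eq_bigr => n /andP[n0 nM].
  transitivity (\sum_(1 <= m < M | m == n) N%:R / 2 * (b n * c m)); last first.
    by rewrite big_nat1_eq n0 nM.
  rewrite [RHS]big_mkcond /= !big_nat; apply: eq_bigr => m /andP[m0 mM].
  under eq_bigr do rewrite mulrACA.
  rewrite -mulr_sumr (sum_Im_prim_root hz n0); last by rewrite ltnS leq_add// ltnW.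
  by rewrite eq_sym; case: eqP => _; rewrite ?mulr0// mulrC.
by rewrite pmulr_rge0// divr_gt0.
Qed.

(** The form on the disk of [|sin (n t)| <= n |sin t|], by induction from the addition formula. *)
Lemma normr_ImX z n : normc z <= 1 -> `|Im (z ^+ n)| <= n%:R * `|Im z|.
Proof.
move=> z1; elim: n => [|n IH]; first by rewrite expr0 /= normr0 mul0r.
rewrite exprS cImM -natr1 mulrDl mul1r; apply: (le_trans (ler_normD _ _)).
rewrite !normrM; apply: lerD.
  apply: le_trans IH; rewrite ler_piMl//; exact: le_trans (normr_Re _) _.
rewrite ler_piMr//; apply: (le_trans (normr_Re _)).
by rewrite normcX exprn_ile1// normc_ge0.
Qed.

Lemma geometric_tail s M M' : 0 <= s -> s < 1 -> (M <= M')%N ->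
  \sum_(M <= n < M') s ^+ n <= s ^+ M / (1 - s).
Proof.
move=> s0 s1 MM; have s10 : 0 < 1 - s by rewrite subr_gt0.
have -> : \sum_(M <= n < M') s ^+ n = (s ^+ M - s ^+ M') / (1 - s).
  apply: (canRL (mulfK _)); first by rewrite gt_eqF.
  rewrite -[RHS]opprB -telescope_sumr// -sumrN mulr_suml.
  by apply: eq_bigr => n _; rewrite exprSr; ring.
by apply: ler_wpM2r; [rewrite invr_ge0 ltW|rewrite gerBl exprn_ge0].
Qed.

(** The weight [n] is the factor lost in [normr_ImX]: with it, a tail of the series has imaginary
    part at most a geometric tail times [|Im z|]. *)
Definition geometric_bound b :=
  exists C s, [/\ 0 <= C, 0 < s < 1 & forall n, `|b n| * n%:R <= C * s ^+ n].

(** Nonnegative imaginary part of the sum on the upper half-circle, expressed by partial sums so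
    that no limit function has to be named. The rank [M0] may depend on [z]; [truncation] makes it
    uniform. *)
Definition upper_positive b := forall z, normc z = 1 -> 0 < Im z -> forall e, 0 < e ->
  exists M0, forall M, (M0 <= M)%N -> - e <= Im (psum b M z).

Lemma expr_small s C e : 0 <= C -> 0 < s < 1 -> 0 < e ->
  exists M0, forall M, (M0 <= M)%N -> C * s ^+ M < e.
Proof.
move=> C0 /andP[s0 s1] e0.
have : geometric C s @ \oo --> (0 : R).
  by apply: cvg_geometric; rewrite gtr0_norm.
move=> /cvgrPdist_lt/(_ e e0)[M0 _ h]; exists M0 => M /h /=.
by rewrite sub0r normrN; apply: le_lt_trans; exact: ler_norm.
Qed.

Lemma psum_split b M M' z : (0 < M)%N -> (M <= M')%N ->
  psum b M' z = psum b M z + \sum_(M <= n < M') (b n)%:C * z ^+ n.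
Proof. by move=> M0 MM; exact: big_cat_nat. Qed.

(* A truncation loses positivity by at most a multiple of [Im z],
   because [`|Im (z ^+ n)| <= n * `|Im z|] on the unit disk. *)
Lemma truncation b : geometric_bound b -> upper_positive b -> forall e, 0 < e ->
  exists M0, forall M, (M0 <= M)%N -> forall z, normc z = 1 ->
    0 <= Im (psum b M z + e%:C * z) * Im z.
Proof.
move=> [C [s [C0 s01 hb]]] ub e e0; have /andP[s0 s1] := s01.
have s10 : 0 < 1 - s by rewrite subr_gt0.
have D0 : 0 <= C / (1 - s) by rewrite divr_ge0// ltW.
have [M0 hM0] := expr_small D0 s01 e0.
exists M0.+1 => M hM z z1.
have pos u : normc u = 1 -> 0 < Im u -> 0 <= Im (psum b M u + e%:C * u).
  move=> u1 u0; apply/ler_addgt0Pr => d d0.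
  have [M1 hM1] := ub u u1 u0 d d0.
  have := hM1 (maxn M M1) (leq_maxr _ _).
  rewrite (@psum_split b M _ u (leq_trans (ltn0Sn _) hM) (leq_maxl _ _)) !cImD cImZ.
  suff : `|Im (\sum_(M <= n < maxn M M1) (b n)%:C * u ^+ n)| <= e * Im u.
    by rewrite ler_norml => /andP[? ?] ?; lra.
  rewrite cIm_sum; apply: (le_trans (ler_norm_sum _ _ _)).
  apply: (@le_trans _ _ (\sum_(M <= n < maxn M M1) C * s ^+ n * Im u)).
    apply: ler_sum => n _; rewrite cImZ normrM.
    apply: (@le_trans _ _ (`|b n| * (n%:R * Im u))).
      by rewrite ler_wpM2l// -[X in _ * X]gtr0_norm// normr_ImX// u1.
    by rewrite mulrA ler_wpM2r// ltW.
  rewrite -mulr_suml ler_wpM2r ?(ltW u0)// -mulr_sumr.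
  apply: le_trans (ltW (hM0 M (ltnW hM))); rewrite -mulrA ler_wpM2l// mulrC.
  by apply: geometric_tail => //; [exact: ltW|exact: leq_maxl].
case: (ltgtP (Im z) 0) => [zn|zp|->]; last by rewrite mulr0.
- have /pos : normc z^*%C = 1 by rewrite normc_conj.
  have Ic u : Im u^*%C = - Im u by case: u.
  have -> : psum b M z^*%C + e%:C * z^*%C = (psum b M z + e%:C * z)^*%C.
    by rewrite psum_conj rmorphD rmorphM; congr (_ + _ * _); rewrite /= oppr0.
  rewrite !Ic oppr_gt0 oppr_ge0 => /(_ zn) h.
  by rewrite -mulrNN mulr_ge0// oppr_ge0// ltW.
- by rewrite mulr_ge0 ?pos// ltW.
Qed.

(** Adding [t z] to both truncations makes them positive and changes only the first coefficients, so
    the pairing moves by [t * (b 1 + c 1 + t)]. The choice of [t] keeps this below [e]. *)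
Lemma kernel_ge0 b c : geometric_bound b -> upper_positive b ->
  geometric_bound c -> upper_positive c ->
  forall e, 0 < e -> exists M0, forall M, (M0 <= M)%N ->
    - e <= \sum_(1 <= n < M) b n * c n.
Proof.
move=> gb ub gc uc e e0.
pose K := `|b 1%N| + `|c 1%N| + 1; have K0 : 0 < K by rewrite ltr_wpDl// addr_ge0.
pose t := Num.min 1 (e / K); have t0 : 0 < t by rewrite lt_min ltr01 divr_gt0.
have [t1 tK] : t <= 1 /\ t * K <= e.
  by split; [rewrite ge_min lexx|rewrite -ler_pdivlMr// ge_min lexx orbT].
have [M1 h1] := truncation gb ub t0; have [M2 h2] := truncation gc uc t0.
exists (maxn 2 (maxn M1 M2)) => M; rewrite !geq_max => /and3P[M2' /h1 {}h1 /h2 {}h2].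
pose p (a : nat -> R) n := a n + (if n == 1%N then t else 0).
have pE a z : psum (p a) M z = psum a M z + t%:C * z.
  rewrite /psum !(big_ltn M2') /p eqxx expr1 rmorphD mulrDl addrAC.
  congr (_ + _ + _).
  rewrite !big_nat; apply: eq_bigr => n /andP[n2 _].
  by rewrite gtn_eqF// addr0.
have := @kernel_poly_ge0 (p b) (p c) M.
rewrite (_ : \sum_(1 <= n < M) p b n * p c n =
  \sum_(1 <= n < M) b n * c n + t * (b 1%N + c 1%N + t)); last first.
  rewrite !(big_ltn M2') /p eqxx (_ : \sum_(2 <= i < M) _ = \sum_(2 <= n < M) b n * c n); first by ring.
  by rewrite !big_nat; apply: eq_bigr => n /andP[n2 _]; rewrite gtn_eqF// !addr0.
move=> /(_ _ _)/le_trans; set S := \sum_(1 <= n < M) _; move=> H.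
have {}H : 0 <= S + t * (b 1%N + c 1%N + t).
  by apply: H => [z z1|z z1|]; rewrite ?pE; [exact: h1|exact: h2|].
have : t * (b 1%N + c 1%N + t) <= t * K.
  rewrite ler_pM2l// /K; have := ler_norm (b 1%N); have := ler_norm (c 1%N).
  by move=> ? ?; rewrite lerD// lerD.
move: H tK; clear; lra.
Qed.

End Kernels.

(** * Coefficients of typically real functions *)

Section Coefficients.
Variable R : realType.
Implicit Types (b c : nat -> R) (z : R[i]) (e s x r : R).

Definition sums_to (a : nat -> R[i]) z (l : R[i]) := forall e, 0 < e -> exists N0, forall N,
  (N0 <= N)%N -> normc (\sum_(1 <= n < N) a n * z ^+ n - l) < e.

Lemma sums_to_terms_bounded (a : nat -> R[i]) z l : sums_to a z l ->
  exists2 C, 0 <= C & forall n, (0 < n)%N -> normc (a n * z ^+ n) <= C.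
Proof.
move=> h; have [N0 hN] := h 1 ltr01.
exists (2 + \sum_(k < N0) normc (a k * z ^+ k)).
  by rewrite addr_ge0// sumr_ge0// => k _; exact: normc_ge0.
move=> n n0; case: (leqP N0 n) => hn.
  have := hN _ hn; have := hN _ (leqW hn); rewrite big_nat_recr//=.
  set S := \sum_(1 <= _ < n) _; set t := a n * z ^+ n => h1 h2.
  rewrite (_ : t = (S + t - l) - (S - l)); last by ring.
  apply: (le_trans (le_normcD _ _)); rewrite normcN.
  have : 0 <= \sum_(k < N0) normc (a k * z ^+ k) by rewrite sumr_ge0// => k _; exact: normc_ge0.
  lra.
apply: (@le_trans _ _ (\sum_(k < N0) normc (a k * z ^+ k))); last by rewrite lerDr.
rewrite (bigD1 (Ordinal hn))//= lerDl sumr_ge0// => k _; exact: normc_ge0.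
Qed.

(** The identity theorem by strong induction. Convergence at [1/2] gives [|b n| <= C 2^n]; once the
    earlier coefficients vanish, division by [x^m] bounds [|b m|] by a constant times [x]. *)
Lemma real_series_zero b :
  (forall x, 0 < x < 1 -> forall e, 0 < e -> exists N0, forall N, (N0 <= N)%N ->
     `|\sum_(1 <= n < N) b n * x ^+ n| < e) ->
  forall n, (0 < n)%N -> b n = 0.
Proof.
move=> h.
have [C C0 hC] : exists2 C, 0 <= C & forall n, (0 < n)%N -> `|b n| <= C * 2 ^+ n.
  have := @sums_to_terms_bounded (fun n => (b n)%:C) (2^-1)%:C 0.
  case=> [e e0|C C0 hC].
    have [|N0 hN] := h 2^-1 _ e e0; first lra.
    exists N0 => N /hN; rewrite subr0 -normcR rmorph_sum; congr (normc _ < _).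
    by apply: eq_bigr => n _; rewrite rmorphM rmorphXn.
  exists C => // n /hC; rewrite -rmorphXn -rmorphM normcR normrM.
  by rewrite normrX [`|2^-1|]ger0_norm ?invr_ge0// exprVn ler_pdivrMr// exprn_gt0.
move=> n; elim/ltn_ind: n => m IH m0; apply/eqP; rewrite -normr_le0.
have key x : 0 < x < 4^-1 -> `|b m| <= C * 2 ^+ m.+2 * x.
  move=> /andP[x0 x4]; have xm : 0 < x ^+ m by rewrite exprn_gt0.
  rewrite -(ler_pM2r xm); apply/ler_addgt0Pr => e e0.
  have [|N0 hN] := h x _ e e0; first lra.
  have := hN (maxn N0 m.+1) (leq_maxl _ _); set N := maxn _ _.
  have mN : (m < N)%N by rewrite leq_maxr.
  rewrite (big_cat_nat (n := m)) ?(ltnW mN)//= big1_seq; last first.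
    by move=> k; rewrite mem_index_iota => /andP[_ /andP[k0 km]]; rewrite IH// mul0r.
  rewrite add0r big_ltn// => h1.
  have x2 : 0 <= 2 * x < 1 by apply/andP; split; lra.
  have : `|\sum_(m.+1 <= n < N) b n * x ^+ n| <= C * 2 ^+ m.+2 * x * x ^+ m.
    apply: (le_trans (ler_norm_sum _ _ _)).
    apply: (@le_trans _ _ (\sum_(m.+1 <= n < N) C * (2 * x) ^+ n)).
      rewrite !big_nat; apply: ler_sum => n /andP[n0 _]; rewrite normrM normrX (gtr0_norm x0).
      rewrite exprMn mulrA; apply: ler_wpM2r; first by rewrite exprn_ge0// ltW.
      by apply: hC; exact: leq_trans n0.
    have -> : C * 2 ^+ m.+2 * x * x ^+ m = C * (2 ^+ m.+2 * (x * x ^+ m)) by ring.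
    rewrite -mulr_sumr; apply: ler_wpM2l => //.
    have /andP[x20 x21] := x2.
    apply: (le_trans (geometric_tail x20 x21 mN)).
    rewrite ler_pdivrMr; last lra.
    have -> : 2 ^+ m.+2 * (x * x ^+ m) * (1 - 2 * x) = (2 * x) ^+ m.+1 * (2 * (1 - 2 * x)).
      by rewrite exprMn !exprS; ring.
    by apply: ler_peMr; [rewrite exprn_ge0|lra].
  move=> h2; rewrite -(gtr0_norm xm) -normrM (gtr0_norm xm).
  rewrite -[b m * _](addrK (\sum_(m.+1 <= n < N) b n * x ^+ n)).
  apply: (le_trans (ler_normB _ _)); rewrite addrC lerD//; exact: ltW.
rewrite leNgt; apply/negP => bm.
pose K := C * 2 ^+ m.+2; have K0 : 0 <= K by rewrite mulr_ge0// exprn_ge0.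
(* This makes [K * x < |b m|], against [key]; the bound [1/8] keeps [x] inside the range of
   [key]. *)
pose x := Num.min 8^-1 (`|b m| / (2 * (K + 1))).
have K1 : 0 < 2 * (K + 1) by rewrite mulr_gt0// ltr_wpDl.
have x0 : 0 < x by rewrite lt_min invr_gt0 ltr0n divr_gt0.
have x4 : x < 4^-1 by rewrite gt_min; apply/orP; left; lra.
have xK : x * (2 * (K + 1)) <= `|b m| by rewrite -ler_pdivlMr// ge_min lexx orbT.
have := key x; rewrite x0 x4 -/K => /(_ isT); have := mulr_ge0 K0 (ltW x0).
move: bm x0 xK; clear; move=> *; lra.
Qed.

(** The imaginary part of [f] is positive just above the real axis, negative just below it, and
    continuous across it. *)
Lemma typically_real_axis (f : R[i] -> R[i]) x :
  holomorphic_on_disk f -> typically_real f -> `|x| < 1 -> Im (f x%:C) = 0.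
Proof.
move=> hf tf x1; have nx : normc x%:C < 1 by rewrite normcR.
have /continuous_normcP cf := derivable_continuous_normc (hf _ nx).
apply/eqP; apply: contraT => I0.
have aI : 0 < `|Im (f x%:C)| by rewrite normr_gt0.
have [d d0 hd] := cf _ aI.
pose t := Num.min (d / 2) ((1 - `|x|) / 2).
have t0 : 0 < t by rewrite lt_min !divr_gt0// subr_gt0.
have [td tx] : t < d /\ t < 1 - `|x|.
  split; rewrite gt_min; apply/orP; [left|right]; rewrite ltr_pdivrMr// ltr_pMr ?ltr1n//.
  by rewrite subr_gt0.
have near (y : R) : `|y| = t -> `|Im (f (x +i* y)) - Im (f x%:C)| < `|Im (f x%:C)|.
  move=> yt; rewrite -cImN -cImD; apply: (le_lt_trans (normr_Im _)); apply: hd.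
  apply: (le_lt_trans (normc_ReIm _)).
  by rewrite cReD cImD cReN cImN /= subrr normr0 add0r subr0 yt.
have tr (y : R) : `|y| = t -> 0 < Im (f (x +i* y)) * y.
  move=> yt; apply: (tf (x +i* y)); last by rewrite -normr_gt0 yt.
  by apply: (le_lt_trans (normc_ReIm _)) => /=; rewrite yt; lra.
have := near t (gtr0_norm t0); have := tr t (gtr0_norm t0).
have nt : `|- t| = t by rewrite normrN gtr0_norm.
have := near (- t) nt; have := tr (- t) nt.
rewrite mulrN oppr_gt0 pmulr_lgt0// pmulr_llt0//.
move: I0; rewrite neq_lt => /orP[I0|I0] h1 h2 h3 h4.
  by move: h4; rewrite (ltr0_norm I0) ltr_norml => /andP[? ?]; lra.
by move: h2; rewrite (gtr0_norm I0) ltr_norml => /andP[? ?]; lra.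
Qed.

(** Since [f] is real on the real axis, the imaginary parts of the coefficients form a real series
    vanishing on [(0, 1)]. The representation reads [a] only from index 2 on, so index 1 is reset to
    1. *)
Lemma typically_real_series (a : nat -> R[i]) (f : R[i] -> R[i]) :
  holomorphic_on_disk f -> power_series_rep a f -> typically_real f ->
  exists b, [/\ b 1%N = 1, forall n, (1 < n)%N -> a n = (b n)%:C &
    forall z, normc z < 1 -> sums_to (fun n => (b n)%:C) z (f z)].
Proof.
move=> hf pf tf; pose a' n := if n == 1%N then 1 else a n.
have sa z : normc z < 1 -> sums_to a' z (f z).
  move=> /pf /cvgn_normcP h e /h[N0 hN]; exists (maxn 2 N0) => N.
  rewrite geq_max => /andP[N2 /hN]; rewrite (big_ltn N2) /a' eqxx expr1 mul1r.
  congr (normc (_ + _ - _) < _); rewrite !big_nat; apply: eq_bigr => n /andP[n2 _].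
  by rewrite gtn_eqF.
have Ia n : (0 < n)%N -> Im (a' n) = 0.
  apply: (@real_series_zero (fun n => Im (a' n))) => x /andP[x0 x1] e e0.
  have xn : `|x| < 1 by rewrite gtr0_norm.
  have [|N0 hN] := sa x%:C _ e e0; first by rewrite normcR.
  exists N0 => N /hN; apply: le_lt_trans; apply: le_trans (normr_Im _).
  rewrite cImD cImN typically_real_axis// subr0 cIm_sum le_eqVlt.
  apply/orP; left; apply/eqP; congr `|_|; apply: eq_bigr => n' _.
  by rewrite -rmorphXn [_ * (x ^+ _)%:C]mulrC cImZ mulrC.
have aE n : (0 < n)%N -> a' n = (Re (a' n))%:C.
  by move=> /Ia; case: (a' n) => u v /= ->.
exists (fun n => Re (a' n)); split.
- by rewrite /a' eqxx.
- by move=> n n1; rewrite -aE ?(ltnW n1)// /a' gtn_eqF.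
- move=> z /sa h e /h[N0 hN]; exists N0 => N /hN; congr (normc (_ - _) < _).
  by rewrite !big_nat; apply: eq_bigr => n /andP[n0 _]; rewrite aE.
Qed.

(** Each of the [n] terms [s ^+ k] with [k < n] of the geometric sum is at least [s ^+ n]. *)
Lemma natr_expr_le s n : 0 <= s -> s < 1 -> n%:R * s ^+ n <= (1 - s)^-1.
Proof.
move=> s0 s1; apply: (@le_trans _ _ (\sum_(0 <= k < n) s ^+ k)).
  rewrite mulr_natl -[X in s ^+ n *+ X]subn0 -sumr_const_nat !big_nat.
  by apply: ler_sum => k /andP[_ kn]; apply: ler_wiXn2l; rewrite ?(ltW s1)// ltnW.
by apply: (le_trans (geometric_tail s0 s1 (leq0n n))); rewrite expr0 mul1r.
Qed.

Lemma finite_geometric_bound c K : (forall n, (K <= n)%N -> c n = 0) -> geometric_bound c.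
Proof.
move=> hc; exists (\sum_(k < K) `|c k| * k%:R * 2 ^+ k), 2^-1; split; [|lra|].
  by apply: sumr_ge0 => k _; rewrite !mulr_ge0// exprn_ge0.
have nn k : 0 <= `|c k| * k%:R * 2 ^+ k by rewrite !mulr_ge0// exprn_ge0.
move=> n; have p2 : 0 < (2 : R) ^+ n by rewrite exprn_gt0.
rewrite exprVn ler_pdivlMr//; case: (leqP K n) => h.
  by rewrite hc// normr0 !mul0r sumr_ge0.
by rewrite (bigD1 (Ordinal h))//= lerDl sumr_ge0.
Qed.

Section Series.
Variables (b : nat -> R) (f : R[i] -> R[i]).
Hypothesis b1 : b 1%N = 1.
Hypothesis fE : forall z, normc z < 1 -> sums_to (fun n => (b n)%:C) z (f z).
Hypothesis tf : typically_real f.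

Lemma psum_scale r M z : psum (fun n => b n * r ^+ n) M z = psum b M (r%:C * z).
Proof.
by apply: eq_bigr => n _; rewrite exprMn rmorphM rmorphXn mulrA.
Qed.

(** The radius is factored as [r = rho * t * s]: the terms are bounded at [rho < 1], the powers of
    [t] absorb the weight [n], and the powers of [s] remain as the rate. *)
Lemma series_geometric_bound r : 0 < r < 1 -> geometric_bound (fun n => b n * r ^+ n).
Proof.
move=> /andP[r0 r1]; pose rho := (1 + r) / 2.
have [rho1 rrho] : rho < 1 /\ r < rho by rewrite /rho; split; lra.
have rho0 : 0 < rho by exact: lt_trans rrho.
have nrho : normc rho%:C < 1 by rewrite normcR gtr0_norm.
have [C C0 hC] := sums_to_terms_bounded (fE nrho).
pose q := r / rho; have [q0 q1] : 0 < q /\ q < 1 by rewrite divr_gt0// ltr_pdivrMr// mul1r.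
pose s := (1 + q) / 2; have [s0 s1] : q < s /\ s < 1 by rewrite /s; split; lra.
have s00 : 0 < s by exact: lt_trans s0.
pose t := q / s; have [t0 t1] : 0 <= t /\ t < 1.
  by rewrite divr_ge0 ?ltW// ltr_pdivrMr// mul1r.
have rE : r = rho * (t * s) by rewrite /t divfK ?gt_eqF// /q mulrC divfK// gt_eqF.
clearbody t s q rho.
exists (C * (1 - t)^-1), s; split.
- by rewrite mulr_ge0// invr_ge0 subr_ge0 ltW.
- by rewrite s00 s1.
case=> [|n]; first by rewrite mulr0 !mulr_ge0// ?invr_ge0 ?subr_ge0 ?exprn_ge0// ltW.
move: n.+1 (ltn0Sn n) => {n} m m0; have := hC m m0; rewrite -rmorphXn -rmorphM normcR normrM (gtr0_norm (_ : 0 < rho ^+ _)) ?exprn_gt0//.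
move=> hm.
rewrite rE.
rewrite !exprMn !normrM (gtr0_norm (_ : 0 < rho ^+ _)) ?exprn_gt0//.
rewrite (gtr0_norm (_ : 0 < s ^+ _)) ?exprn_gt0// (ger0_norm (_ : 0 <= t ^+ _)) ?exprn_ge0//.
have -> : `|b m| * (rho ^+ m * (t ^+ m * s ^+ m)) * m%:R
  = (`|b m| * rho ^+ m) * (m%:R * t ^+ m) * s ^+ m by ring.
apply: ler_wpM2r; first by rewrite exprn_ge0// ltW.
apply: ler_pM => //.
- by rewrite mulr_ge0// exprn_ge0// ltW.
- by rewrite mulr_ge0// exprn_ge0.
- exact: natr_expr_le.
Qed.

Lemma series_upper_positive r : 0 < r < 1 -> upper_positive (fun n => b n * r ^+ n).
Proof.
move=> /andP[r0 r1] z z1 Iz e e0.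
have nz : normc (r%:C * z) < 1 by rewrite normcM z1 mulr1 normcR gtr0_norm.
have Irz : 0 < Im (r%:C * z) by rewrite cImZ mulr_gt0.
have := tf nz (lt0r_neq0 Irz); rewrite pmulr_lgt0// => If.
have [N0 hN] := fE nz e0; exists N0 => N /hN.
rewrite psum_scale => /ltW h; have := le_trans (normr_Im _) h.
by rewrite -/(psum b N _) cImD cImN ler_norml => /andP[? _]; lra.
Qed.

Lemma bernoulli (t : R) n : 0 <= t <= 1 -> 1 - n%:R * t <= (1 - t) ^+ n.
Proof.
move=> /andP[t0 t1]; elim: n => [|n IH]; first by rewrite mul0r subr0 expr0.
rewrite exprS; have : 0 <= 1 - t by rewrite subr_ge0.
move=> /ler_wpM2l/(_ _ _ IH); apply: le_trans; rewrite -natr1.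
have : 0 <= n%:R * t * t by rewrite !mulr_ge0.
lra.
Qed.

(* Test [f] against the kernels [n Im z +- Im (z ^+ n)]. *)
Lemma coefficient_bound n : (0 < n)%N -> `|b n| <= n%:R.
Proof.
move=> n0; have [->|n1] := eqVneq n 1%N; first by rewrite b1 normr1.
have n2 : (1 < n)%N by rewrite ltn_neqAle eq_sym n1.
have scaled r : 0 < r < 1 -> `|b n| * r ^+ n <= n%:R.
  move=> r01; have /andP[r0 r1] := r01.
  suff main (sg : bool) : 0 <= n%:R * r + (-1) ^+ sg * (b n * r ^+ n).
    have := main false; have := main true; rewrite expr1 expr0 mulN1r mul1r => h1 h2.
    rewrite -[r ^+ n]gtr0_norm ?exprn_gt0// -normrM.
    apply: (@le_trans _ _ (n%:R * r)); last by rewrite ler_piMr// ltW.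
    by rewrite ler_norml; apply/andP; split; lra.
  (* Pairing with this sequence gives [n r + b n r^n] or [n r - b n r^n], according to [sg]. *)
  pose c k : R := (if k == 1%N then n%:R else 0) + (if k == n then (-1) ^+ sg else 0).
  have sumc (g : nat -> R) M : (n < M)%N ->
      \sum_(1 <= k < M) c k * g k = n%:R * g 1%N + (-1) ^+ sg * g n.
    move=> nM; under eq_bigr do rewrite mulrDl.
    rewrite big_split /=; congr (_ + _).
      transitivity (\sum_(1 <= k < M | k == 1%N) n%:R * g k); last first.
        by rewrite big_nat1_eq (leq_ltn_trans n0 nM).
      by rewrite [RHS]big_mkcond; apply: eq_bigr => k _; case: eqP => // _; rewrite mul0r.
    transitivity (\sum_(1 <= k < M | k == n) (-1) ^+ sg * g k); last first.
      by rewrite big_nat1_eq n0 nM.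
    by rewrite [RHS]big_mkcond; apply: eq_bigr => k _; case: eqP => // _; rewrite mul0r.
  have gc : geometric_bound c.
    apply: (@finite_geometric_bound _ n.+1) => k kn; rewrite /c !gtn_eqF ?addr0//.
    exact: leq_trans kn.
  have uc : upper_positive c.
    move=> z z1 Iz e e0; exists n.+1 => M nM; rewrite Im_psum sumc// expr1.
    have := @normr_ImX _ z n; rewrite z1 lexx => /(_ isT).
    rewrite (gtr0_norm Iz) ler_norml => /andP[h1 h2]; apply: (@le_trans _ _ 0); first lra.
    by case: (sg); rewrite ?expr0 ?expr1; lra.
  apply/ler_addgt0Pr => e e0.
  have [M0 hM] := kernel_ge0 (series_geometric_bound r01) (series_upper_positive r01) gc uc e0.
  have := hM (maxn M0 n.+1) (leq_maxl _ _).
  under eq_bigr do rewrite mulrC; rewrite sumc ?leq_maxr// b1 expr1 mul1r.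
  by move=> ?; lra.
rewrite leNgt; apply/negP => h.
(* The limit [r -> 1] at an explicit radius [1 - t]: by Bernoulli
   [|b n| (1 - t)^n >= |b n| - n t |b n|], and the product subtracted is at most half of
   [|b n| - n]. *)
pose t := Num.min 2^-1 ((`|b n| - n%:R) / (2 * (n%:R * `|b n|))).
have nR : 0 < n%:R :> R by rewrite ltr0n.
have bn : 0 < `|b n| by exact: lt_trans h.
have K0 : 0 < 2 * (n%:R * `|b n|) by rewrite !mulr_gt0.
have t0 : 0 < t by rewrite lt_min invr_gt0 ltr0n divr_gt0// subr_gt0.
have t2 : t <= 2^-1 by rewrite ge_min lexx.
have tK : t * (2 * (n%:R * `|b n|)) <= `|b n| - n%:R by rewrite -ler_pdivlMr// ge_min lexx orbT.
have := scaled (1 - t); have -> : 0 < 1 - t < 1 by apply/andP; split; lra.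
move=> /(_ isT); apply/negP; rewrite -ltNge.
apply: (@lt_le_trans _ _ (`|b n| * (1 - n%:R * t))).
  lra.
by apply: ler_wpM2l => //; apply: bernoulli; apply/andP; split; lra.
Qed.

Lemma series_conj z : normc z < 1 -> f z^*%C = (f z)^*%C.
Proof.
move=> z1; apply/eqP; rewrite -subr_eq0 -normc_eq0 eq_le normc_ge0 andbT.
apply/ler_addgt0Pr => e e0; rewrite add0r.
have [N1 h1] := fE z1 (half_gt0 e0).
have z1' : normc z^*%C < 1 by rewrite normc_conj.
have [N2 h2] := fE z1' (half_gt0 e0).
have {}h1 := h1 _ (leq_maxl N1 N2); have {}h2 := h2 _ (leq_maxr N1 N2).
rewrite -!/(psum b _ _) psum_conj in h1 h2.
set S := psum _ _ _ in h1 h2.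
have -> : f z^*%C - (f z)^*%C = (S - f z)^*%C - (S^*%C - f z^*%C).
  by rewrite rmorphB; ring.
apply: (le_trans (le_normcD _ _)); rewrite normcN normc_conj [leRHS]splitr.
by rewrite lerD// ltW.
Qed.

End Series.
End Coefficients.

(** * Calculus *)

Section Calculus.
Variable R : realType.
Implicit Types (b c : nat -> R) (z u : R[i]) (e s t x y K : R).

Let is_derive_ex (F : R -> R) x l : is_derive x (1 : R) F l -> derivable F x 1.
Proof. by case. Qed.

Lemma ge0_derive_ge0 (F F' : R -> R) : F 0 = 0 ->
  (forall x, is_derive x (1 : R) F (F' x)) -> (forall x, 0 <= x -> 0 <= F' x) ->
  forall x, 0 <= x -> 0 <= F x.
Proof.
move=> F0 dF F'0 x x0.
have [|c /[!in_itv]/= /andP[c0 _]] := @MVT_segment _ F F' 0 x x0 (fun y _ => dF y).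
  apply: derivable_within_continuous => y _; exact: is_derive_ex (dF y).
by rewrite F0 !subr0 => ->; rewrite mulr_ge0// F'0.
Qed.

Lemma sin_ge_cubic x : 0 <= x -> x - x ^+ 3 / 6 <= sin x.
Proof.
move=> x0; rewrite -subr_ge0.
have s1 y : 0 <= y -> 0 <= y - sin y.
  apply: (ge0_derive_ge0 (F := fun y => y - sin y) (F' := fun y => 1 - cos y)); first by rewrite sin0 subr0.
  by move=> y' _; rewrite subr_ge0 cos_le1.
have c1 y : 0 <= y -> 0 <= cos y - 1 + y ^+ 2 / 2.
  apply: (ge0_derive_ge0 (F := fun y => cos y - 1 + y ^+ 2 / 2) (F' := fun y => y - sin y)); last exact: s1.
    by rewrite cos0 expr0n mul0r addr0 subrr.
  by move=> y'; apply: is_derive_eq; rewrite /GRing.scale /=; field.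
move: x x0; apply: (ge0_derive_ge0 (F := fun y => sin y - (y - y ^+ 3 / 6)) (F' := fun y => cos y - 1 + y ^+ 2 / 2)); last exact: c1.
  by rewrite sin0 expr0n mul0r !subr0.
by move=> y; apply: is_derive_eq; rewrite /GRing.scale /=; field.
Qed.

Lemma cos_le_quartic x : 0 <= x -> cos x <= 1 - x ^+ 2 / 2 + x ^+ 4 / 24.
Proof.
move=> x0; rewrite -subr_ge0; move: x x0.
apply: (ge0_derive_ge0 (F := fun y => 1 - y ^+ 2 / 2 + y ^+ 4 / 24 - cos y)
  (F' := fun y => sin y - (y - y ^+ 3 / 6))).
- by rewrite cos0 !expr0n !mul0r subr0 addr0 subrr.
- by move=> y; apply: is_derive_eq; rewrite /GRing.scale /=; field.
- by move=> y y0; rewrite subr_ge0 sin_ge_cubic.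
Qed.

(** The quartic bound gives [cos (sqrt 3) <= 1 - 3/2 + 9/24 = -1/8], so [sqrt 3] lies beyond
    [pi / 2]. *)
Lemma sqr_pi_lt12 : (pi : R) ^+ 2 < 12.
Proof.
pose a : R := Num.sqrt 3; have a0 : 0 <= a by exact: sqrtr_ge0.
have a2 : a ^+ 2 = 3 by rewrite sqr_sqrtr.
have : pi / 2 < a.
  rewrite ltNge; apply/negP => h.
  have : 0 <= cos a.
    by apply: cos_ge0_pihalf; rewrite h andbT (le_trans _ a0)// oppr_le0 divr_ge0// pi_ge0.
  have := cos_le_quartic a0; rewrite (_ : a ^+ 4 = 9); last first.
    by rewrite (_ : 4 = 2 * 2)%N// exprM a2; ring.
  by rewrite a2; lra.
move=> h; have : (pi / 2) ^+ 2 < a ^+ 2.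
  by rewrite ltr_pXn2r// nnegrE// divr_ge0// pi_ge0.
by rewrite a2 expr_div_n; lra.
Qed.

(* Equality holds at the endpoints [x = pi / 2] and [x = - pi / 2], so this is
   exactly as strong as the constant 1/4 requires. *)
Lemma pi_cos_ge x : `|x| <= pi / 2 -> (pi / 2 + x) * (pi / 2 - x) <= pi * cos x.
Proof.
wlog x0 : x / 0 <= x => [H|].
  case: (leP 0 x) => h; first exact: H.
  by rewrite -normrN -cosN => /H; rewrite opprK mulrC; apply; rewrite oppr_ge0 ltW.
rewrite ger0_norm// => xp; pose y := pi / 2 - x.
have y0 : 0 <= y by rewrite subr_ge0.
have -> : cos x = sin y by rewrite -cosBpihalf /y addrAC subrr add0r cosN.
have -> : pi / 2 + x = pi - y by rewrite /y; field.
have ypi : y <= pi / 2 by rewrite /y gerBl.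
have := ler_wpM2l (pi_ge0 R) (sin_ge_cubic y0).
(* In terms of [y] the claim is [y (pi - y) <= pi sin y]; after the cubic lower bound for the sine
   it becomes this inequality, which [y <= pi / 2] reduces to [pi^2 <= 12]. *)
have : 0 <= y ^+ 2 * (6 - pi * y).
  rewrite mulr_ge0 ?sqr_ge0// subr_ge0.
  by apply: (le_trans (ler_wpM2l (pi_ge0 R) ypi)); have := sqr_pi_lt12; rewrite expr2; lra.
rewrite -/y; move: y (sin y) (pi : R) {ypi y0 xp x0} => y sy p; nra.
Qed.

Lemma is_derive_psum c M t : is_derive t (1 : R) (fun t => \sum_(1 <= n < M) c n * t ^+ n)
  (\sum_(1 <= n < M) c n * n%:R * t ^+ n.-1).
Proof.
elim: M => [|[|M] IH].
- rewrite big_geq// (_ : (fun _ => _) = cst 0); first exact: is_derive_cst.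
  by apply/funext => x; rewrite big_geq.
- rewrite big_geq// (_ : (fun _ => _) = cst 0); first exact: is_derive_cst.
  by apply/funext => x; rewrite big_geq.
rewrite big_nat_recr//= (_ : (fun t => \sum_(1 <= n < M.+2) c n * t ^+ n) =
  (fun x => \sum_(1 <= n < M.+1) c n * x ^+ n) + (fun x => c M.+1 * x ^+ M.+1)).
  apply: is_deriveD.
  have -> : (fun x => c M.+1 * x ^+ M.+1) = horner (c M.+1 *: 'X^(M.+1)).
    by apply/funext => x; rewrite hornerZ hornerXn.
  have -> : c M.+1 * M.+1%:R * t ^+ M = (c M.+1 *: 'X^(M.+1))^`().[t].
    by rewrite derivZ derivXn hornerZ hornerMn hornerXn -mulrA mulr_natl.
  exact: is_derive_poly.
by apply/funext => x; rewrite big_nat_recr.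
Qed.

(** The left-hand side is the [t]-derivative of the truncated series of [- log (1 - t g)]; its
    difference from the derivative of the logarithm is the explicit last term. *)
Lemma sum_pow_pred (g : R[i]) (t : R) M : t%:C * g != 1 ->
  \sum_(1 <= n < M.+1) g ^+ n * t%:C ^+ n.-1
    = g / (1 - t%:C * g) - g * (t%:C * g) ^+ M / (1 - t%:C * g).
Proof.
move=> h; have h1 : 1 - t%:C * g != 0 by rewrite subr_eq0 eq_sym.
rewrite -mulrBl; apply: (canRL (mulfK h1)).
elim: M => [|M IH]; first by rewrite big_geq// mul0r expr0 mulr1 subrr.
rewrite big_nat_recr//= mulrDl IH exprMn !exprS exprMn; ring.
Qed.

Lemma normc_1B_ge (g : R[i]) s (t : R) : normc g <= s -> s < 1 -> `|t| <= 1 ->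
  1 - s <= normc (1 - t%:C * g).
Proof.
move=> gs s1 t1; apply: le_trans (ler_normcB _ _).
rewrite normc1 lerD2l lerN2 normcM normcR; apply: le_trans gs.
by rewrite ler_piMl// normc_ge0.
Qed.

Lemma sum_pow_pred_error (g : R[i]) s (t : R) M : normc g <= s -> s < 1 -> `|t| <= 1 ->
  normc (\sum_(1 <= n < M.+1) g ^+ n * t%:C ^+ n.-1 - g / (1 - t%:C * g))
    <= s ^+ M.+1 / (1 - s).
Proof.
move=> gs s1 t1; have := normc_1B_ge gs s1 t1 => h.
have s10 : 0 < 1 - s by rewrite subr_gt0.
have n0 : 0 < normc (1 - t%:C * g) by exact: lt_le_trans h.
have s0 : 0 <= s by exact: le_trans (normc_ge0 g) gs.
rewrite sum_pow_pred; last by move: n0; rewrite normc_gt0 subr_eq0 eq_sym.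
rewrite addrAC subrr add0r normcN normcM normcV normcM normcX normcM normcR.
have tg0 : 0 <= `|t| * normc g by rewrite mulr_ge0// normc_ge0.
have ng0 := normc_ge0 g; apply: ler_pM.
- by rewrite mulr_ge0// exprn_ge0.
- by rewrite invr_ge0 normc_ge0.
- rewrite exprS; apply: ler_pM => //; first exact: exprn_ge0.
  apply: lerXn2r; rewrite ?nnegrE//.
  by apply: le_trans gs; rewrite ler_piMl.
by rewrite lef_pV2.
Qed.

Lemma mvt_bound (F F' : R -> R) K x : `|x| <= 1 ->
  (forall y, `|y| <= 1 -> is_derive y (1 : R) F (F' y)) ->
  (forall y, `|y| <= 1 -> `|F' y| <= K) -> `|F x - F 0| <= K.
Proof.
move=> x1 dF bF; have cF (a0 b0 : R) : -1 <= a0 -> b0 <= 1 -> {within `[a0, b0], continuous F}.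
  move=> a1 b1; apply: derivable_within_continuous => y; rewrite in_itv /= => /andP[h1 h2].
  by apply: is_derive_ex; apply: dF; rewrite ler_norml (le_trans a1)// (le_trans h2).
have x3 := x1; move: x1; rewrite ler_norml => /andP[x1 x2].
have [x0|x0] := leP 0 x.
  have [y|y /[!in_itv]/= /andP[h1 h2] ->] := @MVT_segment _ F F' 0 x x0 _ (cF _ _ (lerN10 R) x2).
    rewrite in_itv /= => /andP[h1 h2]; apply: dF.
    by rewrite gtr0_norm// (le_trans (ltW h2)).
  rewrite subr0 normrM; apply: (le_trans (ler_piMr (normr_ge0 _) x3)); apply: bF.
  by rewrite ger0_norm// (le_trans h2).
have [y|y /[!in_itv]/= /andP[h1 h2] E] := @MVT_segment _ F F' x 0 (ltW x0) _ (cF _ _ x1 ler01).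
  rewrite in_itv /= => /andP[h1 h2]; apply: dF.
  by rewrite ltr0_norm// lerNl (le_trans x1)// ltW.
rewrite distrC E sub0r normrM normrN.
apply: (le_trans (ler_piMr (normr_ge0 _) x3)); apply: bF.
by rewrite ler0_norm// lerNl (le_trans _ h1)// lerNl opprK.
Qed.

(** The truncated series and the logarithm are compared along the segment [t u]: both vanish at
    [t = 0], and their derivatives differ by a geometric tail. Only the real logarithm of
    [|1 - t u|^2] occurs, hence the factor [1/2] and no choice of branch. *)
Lemma log_series u s M : normc u <= s -> s < 1 ->
  `|\sum_(1 <= n < M.+1) Re (u ^+ n) / n%:R + ln (normc (1 - u))| <= s ^+ M.+1 / (1 - s).
Proof.
move=> us s1.
pose N t := (1 - t * Re u) ^+ 2 + (t * Im u) ^+ 2.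
have NE t : N t = normc (1 - t%:C * u) ^+ 2.
  by rewrite sqr_normcE cReD cImD cReN cImN cReZ cImZ /= add0r sqrrN.
have N0 t : `|t| <= 1 -> 0 < N t.
  move=> t1; rewrite NE exprn_gt0//; apply: lt_le_trans (normc_1B_ge us s1 t1).
  by rewrite subr_gt0.
pose F t := \sum_(1 <= n < M.+1) (Re (u ^+ n) / n%:R) * t ^+ n + 2^-1 * ln (N t).
pose F' t := \sum_(1 <= n < M.+1) (Re (u ^+ n) / n%:R) * n%:R * t ^+ n.-1
  + 2^-1 * ((N t)^-1 * (2 * ((1 - t * Re u) * (- Re u)) + 2 * (t * Im u) * Im u)).
have -> : \sum_(1 <= n < M.+1) Re (u ^+ n) / n%:R + ln (normc (1 - u)) = F 1 - F 0.
  rewrite /F; have -> : \sum_(1 <= n < M.+1) Re (u ^+ n) / n%:R * 0 ^+ n = 0.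
    rewrite big_nat; apply: big1 => n /andP[n0 _]; rewrite expr0n gtn_eqF ?mulr0//.
  rewrite add0r (_ : N 0 = 1); last by rewrite /N !mul0r subr0 expr1n expr0n addr0.
  rewrite ln1 mulr0 subr0 NE mul1r; congr (_ + _).
    by apply: eq_bigr => n _; rewrite expr1n mulr1.
  have n1 : 0 < normc (1 - u).
    have := normc_1B_ge us s1 (_ : `|1| <= 1 :> R); rewrite normr1 mul1r => /(_ (lexx _)).
    by apply: lt_le_trans; rewrite subr_gt0.
  by rewrite lnXn//; field.
apply: (@mvt_bound F F'); first by rewrite normr1.
  move=> t t1; rewrite /F /F'; apply: is_deriveD; first exact: is_derive_psum.
  have dN : is_derive t (1 : R) N (2 * ((1 - t * Re u) * (- Re u)) + 2 * (t * Im u) * Im u).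
    by rewrite /N; apply: is_derive_eq; rewrite /GRing.scale /=; ring.
  have := is_derive1_comp (is_derive1_ln (N0 t t1)) dN.
  by move=> ?; apply: is_deriveZ.
move=> t t1; apply: le_trans (sum_pow_pred_error M us s1 t1).
have -> : F' t = Re (\sum_(1 <= n < M.+1) u ^+ n * t%:C ^+ n.-1 - u / (1 - t%:C * u)).
  rewrite cReD cReN cRe_sum /F'; congr (_ + _).
    rewrite !big_nat; apply: eq_bigr => n /andP[n0 _].
    rewrite -rmorphXn mulrC [in RHS]mulrC cReZ divfK// pnatr_eq0 -lt0n//.
  have nN := lt0r_neq0 (N0 t t1); rewrite /N in nN *.
  move: nN; case: (u) => p q /=; rewrite !mul0r !subr0 !addr0 !add0r sqrrN => nN.
  by field.
exact: normr_Re.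
Qed.

End Calculus.

(** * Values omitted by polynomials *)

Section TestKernel.
Variable R : realType.
Implicit Types (p q x c : R) (z : R[i]).

(** Paired with the coefficients of a series [h], this sequence gives [A h(x) - B h(-x) - c h'(0)];
    its positivity turns into a lower bound for the two values on the real axis. *)
Definition test_kernel A B c x n : R :=
  A * x ^+ n - B * (- x) ^+ n - (if n == 1%N then c else 0).

Lemma test_kernel_geometric A B c x : 0 <= A -> 0 <= B -> 0 <= c -> 0 < x < 1 ->
  geometric_bound (test_kernel A B c x).
Proof.
move=> A0 B0 c0 /andP[x0 x1]; pose s := (1 + x) / 2; pose t := x / s.
have [xs s1] : x < s /\ s < 1 by rewrite /s; split; lra.
have s0 : 0 < s by exact: lt_trans xs.
have [t0 t1] : 0 <= t /\ t < 1 by rewrite divr_ge0 ?ltW// ltr_pdivrMr// mul1r.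
have xE : x = t * s by rewrite /t divfK// gt_eqF.
have D0 : 0 <= (1 - t)^-1 by rewrite invr_ge0 subr_ge0 ltW.
exists ((A + B) * (1 - t)^-1 + c / s), s; split; [|by rewrite s0|].
  by apply: addr_ge0; [rewrite mulr_ge0// addr_ge0|rewrite divr_ge0// ltW].
move=> n; have sn : 0 <= s ^+ n by rewrite exprn_ge0// ltW.
rewrite mulrDl; apply: (@le_trans _ _ ((A + B) * x ^+ n * n%:R + (if n == 1%N then c else 0))).
  have cn : (if n == 1%N then c else 0) = (if n == 1%N then c else 0) * n%:R.
    by case: eqP => [->|_]; rewrite ?mulr1 ?mul0r.
  rewrite cn -mulrDl ler_wpM2r//; apply: (le_trans (ler_normB _ _)); apply: lerD.
    apply: (le_trans (ler_normB _ _)); rewrite mulrDl !normrM !normrX normrN (gtr0_norm x0).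
    by rewrite !ger0_norm.
  by case: ifP => _; rewrite ger0_norm.
apply: lerD.
  have -> : (A + B) * x ^+ n * n%:R = (A + B) * (n%:R * t ^+ n) * s ^+ n.
    by rewrite [in LHS]xE exprMn; ring.
  by apply: ler_wpM2r => //; apply: ler_wpM2l; [rewrite addr_ge0|exact: natr_expr_le].
case: eqP => [->|_]; first by rewrite expr1 divfK// gt_eqF.
by rewrite mulr_ge0// divr_ge0// ltW.
Qed.

(* Cauchy-Schwarz, with [D1 + D2 = 2 (1 + x^2)] for the two denominators. *)
Lemma test_kernel_upper_positive p q x : 0 < x < 1 ->
  upper_positive (test_kernel (p ^+ 2) (q ^+ 2) ((p + q) ^+ 2 * x / (2 * (1 + x ^+ 2))) x).
Proof.
move=> x01 z z1 Iz e e0; have /andP[x0 x1] := x01.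
set c := _ / _; set A := p ^+ 2; set B := q ^+ 2.
have A0 : 0 <= A by exact: sqr_ge0.
have B0 : 0 <= B by exact: sqr_ge0.
have D0 : 0 <= (A + B) * x / (1 - x).
  by rewrite divr_ge0 ?subr_ge0 ?(ltW x1)// mulr_ge0 ?addr_ge0// ltW.
have [M0 hM0] := expr_small D0 x01 e0.
exists (maxn 2 M0.+1) => -[|M]; first by rewrite geq_max.
rewrite geq_max !ltnS => /andP[M1 /hM0 {}hM0].
pose G y := \sum_(1 <= n < M.+1) (y : R[i]) ^+ n.
have GE y : normc y <= x -> `|Im (G y) - Im (y / (1 - y))| <= x ^+ M.+1 / (1 - x).
  move=> yx; have := @sum_pow_pred_error _ y x 1 M yx x1.
  rewrite normr1 => /(_ (lexx _)) h; rewrite -cImN -cImD; apply: (le_trans (normr_Im _)).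
  move: h; rewrite mul1r; congr (normc (_ - _) <= _).
  by apply: eq_bigr => n _; rewrite expr1n mulr1.
have E : psum (test_kernel A B c x) M.+1 z
    = A%:C * G (x%:C * z) - B%:C * G ((- x)%:C * z) - c%:C * z.
  have -> : c%:C * z = \sum_(1 <= n < M.+1) (if n == 1%N then c else 0)%:C * z ^+ n.
    rewrite big_ltn// eqxx expr1 big_nat big1 ?addr0// => n /andP[n1 _].
    by rewrite gtn_eqF// mul0r.
  rewrite /G !mulr_sumr -!sumrB; apply: eq_bigr => n _.
  by rewrite /test_kernel !rmorphB !rmorphM !exprMn !rmorphXn; ring.
have nx (y : R) : `|y| = x -> normc (y%:C * z) <= x.
  by move=> yx; rewrite normcM normcR yx z1 mulr1.
have h1 := GE _ (nx x (gtr0_norm x0)).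
have h2 := GE _ (nx (- x) (etrans (normrN x) (gtr0_norm x0))).
rewrite E !cImD !cImN !cImZ.
have zz : Re z ^+ 2 + Im z ^+ 2 = 1 by rewrite -sqr_normcE z1 expr1n.
(* On the unit circle the denominator is [|1 - y z|^2]. For [y = x] and [y = - x] the terms linear
   in [Re z] are opposite, so the sum of the two denominators is independent of [z]. *)
have ImE (y : R) : Im (y%:C * z / (1 - y%:C * z)) = y * Im z / (1 - 2 * y * Re z + y ^+ 2).
  have -> : 1 - 2 * y * Re z + y ^+ 2 = (1 - y * Re z) ^+ 2 + (y * Im z) ^+ 2.
    apply/eqP; rewrite -subr_eq0; apply/eqP.
    transitivity (y ^+ 2 * (1 - (Re z ^+ 2 + Im z ^+ 2))); first by ring.
    by rewrite zz subrr mulr0.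
  case: (z) => a b' /=; rewrite !mul0r !subr0 !addr0 !add0r sqrrN.
  set D := (1 - y * a) ^+ 2 + (y * b') ^+ 2; ring.
rewrite !ImE in h1 h2.
set D1 := 1 - 2 * x * Re z + x ^+ 2 in h1.
set D2 := 1 - 2 * (- x) * Re z + (- x) ^+ 2 in h2.
have [ra rb] : -1 <= Re z /\ Re z <= 1.
  by have := normr_Re z; rewrite z1 ler_norml => /andP.
have D10 : 0 < D1.
  have : 0 < (1 - x) ^+ 2 by rewrite exprn_gt0// subr_gt0.
  have : 0 <= x * (1 - Re z) by rewrite mulr_ge0 ?subr_ge0// ltW.
  by rewrite /D1; lra.
have D20 : 0 < D2.
  have : 0 < (1 - x) ^+ 2 by rewrite exprn_gt0// subr_gt0.
  have : 0 <= x * (1 + Re z) by rewrite mulr_ge0 ?(ltW x0)//; lra.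
  by rewrite /D2; lra.
have DD : 2 * (1 + x ^+ 2) = D1 + D2 by rewrite /D1 /D2; ring.
have main : c * Im z <= A * (x * Im z / D1) - B * (- x * Im z / D2).
  rewrite /c DD -subr_ge0.
  have -> : A * (x * Im z / D1) - B * (- x * Im z / D2) - (p + q) ^+ 2 * x / (D1 + D2) * Im z
    = x * Im z * (p * D2 - q * D1) ^+ 2 / (D1 * D2 * (D1 + D2)).
    by rewrite /A /B; clearbody D1 D2; field; rewrite ?gt_eqF// ?addr_gt0.
  apply: divr_ge0; last by rewrite ltW// !mulr_gt0// addr_gt0.
  by rewrite mulr_ge0 ?sqr_ge0// mulr_ge0// ltW.
move: h1 h2; rewrite !ler_norml => /andP[k1 _] /andP[_ k4].
have := ler_wpM2l A0 k1; have := ler_wpM2l B0 k4.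
have small : A * (x ^+ M.+1 / (1 - x)) + B * (x ^+ M.+1 / (1 - x)) < e.
  apply: le_lt_trans hM0; rewrite -mulrDl exprS.
  by rewrite le_eqVlt; apply/orP; left; apply/eqP; field; rewrite subr_eq0 gt_eqF.
move: main small; rewrite !mulrBr mulrN.
move: (A * _) (A * _) (A * _) (B * _) (B * _) (B * _) (c * _) => *; lra.
Qed.

End TestKernel.

(** * Factorisation over inverse roots and the covering estimate for polynomials *)

Section PolynomialCovering.
Variable R : realType.
Implicit Types (gs : seq R[i]) (g z : R[i]).

Lemma poly_no_root_disk (p : {poly R[i]}) : (forall z, normc z <= 1 -> p.[z] != 0) ->
  exists2 gs, forall g, g \in gs -> normc g < 1 &
    p = p.[0] *: \prod_(g <- gs) (1 - g *: 'X).
Proof.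
move=> hp; have [r Dp] := closed_field_poly_normal p.
have r1 y : y \in r -> 1 < normc y.
  move=> yr; rewrite ltNge; apply/negP => /hp; rewrite Dp hornerZ mulf_eq0 negb_or.
  by rewrite -/(root _ y) root_prod_XsubC yr andbF.
have E : \prod_(y <- r) ('X - y%:P) = (\prod_(y <- r) - y) *: \prod_(g <- map GRing.inv r) (1 - g *: 'X).
  elim: r r1 {Dp} => [|y r IH] r1; first by rewrite /= !big_nil scale1r.
  rewrite /= !big_cons IH; last by move=> x xr; apply: r1; rewrite inE xr orbT.
  have y0 : y != 0 by rewrite -normc_gt0 (lt_trans ltr01)// r1// inE eqxx.
  have -> : 'X - y%:P = (- y) *: (1 - y^-1 *: 'X).
    by rewrite scalerBr scalerA mulNr divff// scaleN1r opprK scaleNr alg_polyC addrC.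
  by rewrite -scalerAl -scalerAr scalerA.
exists (map GRing.inv r).
  by move=> g /mapP[y /r1 y1 ->]; rewrite normcV invf_lt1// (lt_trans ltr01).
pose c := lead_coef p * \prod_(y <- r) - y.
have pc : p = c *: \prod_(g <- map GRing.inv r) (1 - g *: 'X) by rewrite {1}Dp E scalerA.
suff -> : p.[0] = c by exact: pc.
clearbody c; rewrite pc hornerZ horner_prod big1 ?mulr1// => g _.
by rewrite !hornerE; ring.
Qed.

Lemma horner_prod_lin gs z : (\prod_(g <- gs) (1 - g *: 'X)).[z] = \prod_(g <- gs) (1 - z * g).
Proof. by rewrite horner_prod; apply: eq_bigr => g _; rewrite !hornerE mulrC. Qed.

Lemma deriv_prod_lin gs z : (forall g, g \in gs -> 1 - z * g != 0) ->
  (\prod_(g <- gs) (1 - g *: 'X))^`().[z]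
    = - (\prod_(g <- gs) (1 - z * g)) * \sum_(g <- gs) g / (1 - z * g).
Proof.
elim: gs => [|g gs IH] h; first by rewrite !big_nil derivC horner0 mulr0.
rewrite !big_cons derivM hornerD !hornerM IH; last first.
  by move=> x xg; apply: h; rewrite inE xg orbT.
rewrite horner_prod_lin derivB derivC derivZ derivX sub0r !hornerE.
have g0 : 1 - z * g != 0 by apply: h; rewrite inE eqxx.
by rewrite /=; field.
Qed.

Lemma sum_seq_le gs (F : R[i] -> R) K : (forall g, g \in gs -> F g <= K) ->
  \sum_(g <- gs) F g <= (size gs)%:R * K.
Proof.
elim: gs => [|g gs IH] h; first by rewrite big_nil mul0r.
rewrite big_cons /= -natr1 mulrDl mul1r addrC; apply: lerD.
  by apply: IH => x xg; apply: h; rewrite inE xg orbT.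
by apply: h; rewrite inE eqxx.
Qed.

Lemma uniform_bound gs : (forall g, g \in gs -> normc g < 1) ->
  exists2 s : R, 0 < s < 1 & forall g, g \in gs -> normc g <= s.
Proof.
elim: gs => [|g gs IH] h; first by exists 2^-1 => //; apply/andP; split; lra.
have [|s /andP[s0 s1] hs] := IH; first by move=> x xg; apply: h; rewrite inE xg orbT.
exists (Num.max s (normc g)).
  by rewrite lt_max s0 gt_max s1 h// inE eqxx.
move=> x; rewrite inE le_max => /orP[/eqP ->|/hs ->]//.
by rewrite lexx orbT.
Qed.

Lemma sum_ln_normc gs z : (forall g, g \in gs -> 1 - z * g != 0) ->
  \sum_(g <- gs) ln (normc (1 - z * g)) = ln (normc (\prod_(g <- gs) (1 - z * g)))
  /\ 0 < normc (\prod_(g <- gs) (1 - z * g)).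
Proof.
elim: gs => [|g gs IH] h; first by rewrite !big_nil normc1 ln1.
have [|IH1 IH2] := IH; first by move=> x xg; apply: h; rewrite inE xg orbT.
have g0 : 0 < normc (1 - z * g) by rewrite normc_gt0 h// inE eqxx.
by rewrite !big_cons normcM lnM ?posrE// IH1 mulr_gt0.
Qed.

(** The final elimination, with [N = |w|], [t = Im w], [p1] the derivative at 0, [D = 1 + x^2] and
    [Z = pi]. For the weights [1/X] and [1/Y] the quotient [(p^2 X + q^2 Y) / (p + q)^2] takes its
    least value [X Y / (X + Y)]. *)
Lemma covering_algebra (X Y D N p1 t x Z : R) : 0 < X -> 0 < Y -> 0 < D -> 0 < N ->
  0 <= x -> 0 <= p1 -> X + Y = Z -> X * Y * N <= Z * t ->
  (X^-1 + Y^-1) ^+ 2 * x / (2 * D) * (2 * (p1 * t / N ^+ 2))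
    <= X^-1 ^+ 2 * (2 * X) + Y^-1 ^+ 2 * (2 * Y) -> p1 * x / (2 * D) <= N.
Proof.
move=> X0 Y0 D0 N0 x0 p10 XY hN.
have K0 : 0 < X * Y * D * N ^+ 2 * (X * Y) / Z.
  by rewrite divr_gt0 -?XY ?addr_gt0// !mulr_gt0 ?exprn_gt0.
have Z0 : 0 < Z by rewrite -XY addr_gt0.
move=> /(ler_wpM2l (ltW K0)).
have -> : X * Y * D * N ^+ 2 * (X * Y) / Z * ((X^-1 + Y^-1) ^+ 2 * x / (2 * D) *
   (2 * (p1 * t / N ^+ 2))) = p1 * x * (Z * t).
  rewrite -XY; field; rewrite (gt_eqF X0) (gt_eqF Y0) (gt_eqF D0) (gt_eqF N0) ?andbT//=.
  by rewrite gt_eqF// addr_gt0.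
have -> : X * Y * D * N ^+ 2 * (X * Y) / Z * (X^-1 ^+ 2 * (2 * X) + Y^-1 ^+ 2 * (2 * Y))
  = X * Y * N * (2 * D * N).
  rewrite -XY; field; rewrite (gt_eqF X0) (gt_eqF Y0) ?andbT//=.
  by rewrite gt_eqF// addr_gt0.
move=> h; rewrite ler_pdivrMr ?mulr_gt0//.
have XYN : 0 < X * Y * N by rewrite !mulr_gt0.
rewrite -(ler_pM2l XYN) mulrC [N * _]mulrC; apply: le_trans h.
by apply: ler_wpM2l; rewrite ?mulr_ge0.
Qed.

Section Covering.
Variables (q : {poly R}) (w : R[i]).
Let P z := (map_poly (real_complex R) q).[z].
Let u := Re w.
Let v := Im w.
Hypothesis q0 : q.[0] = 0.
Hypothesis v0 : 0 < v.
Hypothesis Pw : forall z, normc z <= 1 -> P z != w.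
Hypothesis P_up : forall z, normc z = 1 -> 0 < Im z -> 0 <= Im (P z).

Let PR (x : R) : P x%:C = (q.[x])%:C.
Proof. exact: horner_map. Qed.

Let P_conj z : P z^*%C = (P z)^*%C.
Proof.
rewrite /P -horner_map; congr (_.[_]); rewrite -map_poly_comp.
by apply: eq_map_poly => x /=; rewrite oppr0.
Qed.

Let w0 : w != 0.
Proof. by apply: contraTneq v0 => w0; rewrite /v w0 ltxx. Qed.

(** The last clause is the imaginary part of the logarithmic derivative of [P - w]. On the real axis
    it equals the derivative of [atan ((q - u) / v)], which links the inverse roots to the
    arctangent. *)
Lemma covering_data : exists gs, exists2 s : R, 0 < s < 1 &
  [/\ forall g, g \in gs -> normc g <= s,
     forall z, P z - w = - w * \prod_(g <- gs) (1 - z * g) &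
     forall x : R, `|x| <= 1 -> q^`().[x] * v / ((q.[x] - u) ^+ 2 + v ^+ 2)
       = - Im (\sum_(g <- gs) g / (1 - x%:C * g))].
Proof.
pose p := map_poly (real_complex R) q - w%:P.
have pE z : p.[z] = P z - w by rewrite hornerD hornerN hornerC.
have [|gs gs1 gsE] := @poly_no_root_disk p.
  by move=> z /Pw; rewrite pE subr_eq0.
have p0 : p.[0] = - w by rewrite pE -[0]/(0%:C) PR q0 sub0r.
have [s s01 gs_s] := uniform_bound gs1; have /andP[s0 s1] := s01.
exists gs, s => //; split=> // [z|x x1].
  by rewrite -pE gsE hornerZ p0 horner_prod_lin.
have nz g : g \in gs -> 1 - x%:C * g != 0.
  move=> /gs_s gs'; rewrite -normc_gt0; apply: lt_le_trans (normc_1B_ge gs' s1 x1).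
  by rewrite subr_gt0.
have dp : p^`().[x%:C] = (q^`().[x])%:C.
  by rewrite derivB derivC subr0 deriv_map horner_map.
have := dp; rewrite gsE derivZ hornerZ p0 deriv_prod_lin//.
set Pi := \prod_(g <- gs) _; set Sg := \sum_(g <- gs) _ => E1.
have E2 : - w * Pi = (q.[x])%:C - w by rewrite -PR -pE gsE hornerZ p0 horner_prod_lin.
have E3 : (q^`().[x])%:C = - (((q.[x])%:C - w) * Sg) by rewrite -E1 -E2; ring.
have nw : (q.[x])%:C - w != 0.
  by rewrite -PR subr_eq0; apply: Pw; rewrite normcR.
have -> : Sg = - ((q^`().[x])%:C / ((q.[x])%:C - w)) by rewrite E3 mulNr opprK mulrC mulKf.
rewrite cImN opprK cImZ /u /v; case: (w) => a b' /=.
rewrite !add0r sqrrN; set D := (_ - a) ^+ 2 + b' ^+ 2; by ring.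
Qed.

Lemma polynomial_covering (x : R) : 0 < x < 1 -> 0 <= q^`().[0] ->
  q^`().[0] * x / (2 * (1 + x ^+ 2)) <= normc w.
Proof.
move=> x01 p10; have /andP[x0 x1] := x01.
have [gs [s s01 [gs_s PE dE]]] := covering_data.
have /andP[s0 s1] := s01; have s10 : 0 < 1 - s by rewrite subr_gt0.
pose d : R := (size gs)%:R; have d0 : 0 <= d by rewrite ler0n.
pose S n := \sum_(g <- gs) g ^+ n.
(* The Taylor coefficients of [-i (log (1 - P/w) - log (1 - P/conj w))]: the inverse roots of the
   two factors are conjugate, because [q] is real, so the power sums combine to [2 i Im (S n)]. *)
pose h n : R := - 2 * Im (S n) / n%:R.
have gh : geometric_bound h.
  exists (2 * d), s; split => //; first by rewrite mulr_ge0.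
  case=> [|n]; first by rewrite mulr0 expr0 mulr1 mulr_ge0.
  rewrite /h normrM normfV [`|n.+1%:R|]ger0_norm// divfK ?pnatr_eq0//.
  rewrite normrM normrN [`|2|]ger0_norm// -mulrA ler_wpM2l//.
  apply: (le_trans (normr_Im _)); apply: (le_trans (normc_sum _ _ _)).
  by apply: sum_seq_le => g /gs_s gs'; rewrite normcX lerXn2r ?nnegrE ?normc_ge0// ltW.
(* Chosen so that [C * s ^+ M] is the total error of two logarithmic series for each of the [d]
   inverse roots, cut after the term of index [M]. *)
pose C := 2 * d * s / (1 - s).
have C0 : 0 <= C by rewrite divr_ge0 ?(ltW s10)// !mulr_ge0// ltW.
have CE M : C * s ^+ M = 2 * (d * (s ^+ M.+1 / (1 - s))).
  by rewrite /C exprS; field; rewrite gt_eqF.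
have nz z g : normc z <= 1 -> g \in gs -> 1 - z * g != 0.
  move=> z1 /gs_s gs'; have := @normc_1B_ge _ (z * g) s 1.
  rewrite mul1r normr1 -normc_gt0 => k; apply: (lt_le_trans s10); apply: k => //.
  by rewrite normcM; apply: le_trans gs'; rewrite ler_piMl ?normc_ge0.
have uh : upper_positive h.
  move=> z z1 Iz e e0; have [M0 hM0] := expr_small C0 s01 e0.
  exists M0.+1 => -[//|M]; rewrite ltnS => /hM0 {}hM0.
  pose L y := \sum_(1 <= n < M.+1) Re ((y : R[i]) ^+ n) / n%:R.
  have -> : Im (psum h M.+1 z) = \sum_(g <- gs) (L (z * g) - L (z * g^*%C)).
    rewrite Im_psum /L; under [RHS]eq_bigr do rewrite -sumrB.
    rewrite exchange_big /=; apply: eq_bigr => n _.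
    rewrite /h /S cIm_sum mulr_sumr !mulr_suml; apply: eq_bigr => g _.
    rewrite !exprMn -rmorphXn !cReM.
    by case: (g ^+ n) => a b' /=; case: (z ^+ n) => a' b'' /=; ring.
  have zle : normc z <= 1 by rewrite z1.
  have zcle : normc z^*%C <= 1 by rewrite normc_conj z1.
  have [l1 n1] := sum_ln_normc (fun g hg => nz z g zle hg).
  have [l2 n2] := sum_ln_normc (fun g hg => nz z^*%C g zcle hg).
  have err g : g \in gs -> - (L (z * g) - L (z * g^*%C))
      - (ln (normc (1 - z * g)) - ln (normc (1 - z^*%C * g))) <= 2 * (s ^+ M.+1 / (1 - s)).
    move=> /gs_s gs'.
    have k1 : normc (z * g) <= s by rewrite normcM z1 mul1r.
    have k2 : normc (z * g^*%C) <= s by rewrite normcM z1 mul1r normc_conj.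
    have -> : normc (1 - z^*%C * g) = normc (1 - z * g^*%C).
      by rewrite -[RHS]normc_conj rmorphB rmorphM rmorph1 /= conjcK.
    have := log_series M k1 s1; have := log_series M k2 s1.
    rewrite -/(L _) -/(L _) !ler_norml => /andP[? ?] /andP[? ?]; lra.
  have := sum_seq_le err; rewrite sumrB sumrN [X in _ - X]sumrB l1 l2 -/d => H.
  have npi y : normc (P y - w) = normc w * normc (\prod_(g <- gs) (1 - y * g)).
    by rewrite PE normcM normcN.
  (* As [P z] and [w] lie on the same side of the real axis, [|P z - w| <= |P z - conj w|]; the
     right-hand side is [|P (conj z) - w|] by conjugation. *)
  have lnle : ln (normc (\prod_(g <- gs) (1 - z * g)))
      <= ln (normc (\prod_(g <- gs) (1 - z^*%C * g))).
    have nw : 0 < normc w by rewrite normc_gt0.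
    rewrite ler_ln ?posrE// -(ler_pM2l nw) -!npi P_conj.
    rewrite -(@ler_pXn2r _ 2) ?nnegrE ?normc_ge0// !sqr_normcE !cReD !cImD !cReN !cImN.
    have := mulr_ge0 (P_up z1 Iz) (ltW v0); rewrite /v.
    by case: (P z) => a b' /=; nra.
  move: hM0; rewrite CE mulrCA => hM0.
  move: H lnle hM0; rewrite [d * (2 * _)]mulrCA.
  move: (d * _) (ln _) (ln _) (\sum_(_ <- _) _) => *; lra.
pose T (y : R) := 2 * (atan ((q.[y] - u) / v) + atan (u / v)).
have hT M (y : R) : `|y| <= 1 ->
    `|\sum_(1 <= n < M.+1) h n * y ^+ n - T y| <= C * s ^+ M.
  move=> y1; rewrite CE.
  pose F t := \sum_(1 <= n < M.+1) h n * t ^+ n - 2 * atan ((q.[t] - u) / v).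
  pose F' t := \sum_(1 <= n < M.+1) h n * n%:R * t ^+ n.-1
     - 2 * ((1 + ((q.[t] - u) / v) ^+ 2)^-1 * (q^`().[t] / v)).
  have -> : \sum_(1 <= n < M.+1) h n * y ^+ n - T y = F y - F 0.
    rewrite /F q0 sub0r mulNr atanN (_ : \sum_(1 <= n < M.+1) h n * 0 ^+ n = 0).
      by rewrite /T; ring.
    by rewrite big_nat; apply: big1 => n /andP[n0 _]; rewrite expr0n gtn_eqF ?mulr0.
  apply: (@mvt_bound _ F F') => // t t1.
    have dq : is_derive t (1 : R) (fun t => (q.[t] - u) / v) (q^`().[t] / v).
      have -> : (fun t => (q.[t] - u) / v) = horner (v^-1 *: (q - u%:P)).
        by apply/funext => t'; rewrite !hornerE mulrC.
      have -> : q^`().[t] / v = (v^-1 *: (q - u%:P))^`().[t].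
        by rewrite derivZ derivB derivC subr0 hornerZ mulrC.
      exact: is_derive_poly.
    have da := @is_derive1_comp R (@atan R) (fun t => (q.[t] - u) / v) t _ _
      (is_derive1_atan _) dq.
    have ds := is_derive_psum h M.+1 t.
    by apply: (is_deriveB ds); apply: is_deriveZ.
  have -> : F' t = - 2 * Im (\sum_(g <- gs) (\sum_(1 <= n < M.+1) g ^+ n * t%:C ^+ n.-1
      - g / (1 - t%:C * g))).
    rewrite sumrB cImD cImN mulrDr /F'; congr (_ + _).
      rewrite exchange_big cIm_sum mulr_sumr !big_nat; apply: eq_bigr => n /andP[n0 _].
      rewrite /h divfK ?pnatr_eq0 -?lt0n// -mulr_suml -rmorphXn [_ * (t ^+ _)%:C]mulrC cImZ.
      by rewrite /S; ring.
    rewrite -dE//; have vn := lt0r_neq0 v0.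
    have sn : (q.[t] - u) ^+ 2 + v ^+ 2 != 0.
      by rewrite gt_eqF// ltr_wpDl ?sqr_ge0// exprn_gt0.
    by field; apply/andP; split; [exact: sn|exact: vn].
  rewrite normrM normrN [`|2|]ger0_norm// ler_wpM2l//.
  apply: (le_trans (normr_Im _)); apply: (le_trans (normc_sum _ _ _)).
  by apply: sum_seq_le => g /gs_s gs'; exact: sum_pow_pred_error.
have h1 : h 1%N = 2 * (q^`().[0] * v / normc w ^+ 2).
  have := dE 0; rewrite normr0 => /(_ ler01); rewrite q0 sub0r sqrrN -sqr_normcE => ->.
  rewrite /h /S divr1 mulrN mulNr; congr (- (_ * Im _)).
  by apply: eq_bigr => g _; rewrite expr1 mul0r subr0 divr1.
(* The range of the arctangent confines [T] between [- 2 Y] and [2 X], whatever the values of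
   [q]. *)
pose beta := atan (u / v); pose X := pi / 2 + beta; pose Y := pi / 2 - beta.
have X0 : 0 < X by have := atan_gtNpi2 (u / v); rewrite /X /beta; lra.
have Y0 : 0 < Y by have := atan_ltpi2 (u / v); rewrite /Y /beta; lra.
pose c := (X^-1 + Y^-1) ^+ 2 * x / (2 * (1 + x ^+ 2)).
have x20 : 0 < 1 + x ^+ 2 by rewrite ltr_pwDl// sqr_ge0.
have c0 : 0 <= c.
  by apply: divr_ge0; apply: mulr_ge0 => //; (exact: sqr_ge0 || exact: ltW).
have gk := test_kernel_geometric (sqr_ge0 X^-1) (sqr_ge0 Y^-1) c0 x01.
have uk := test_kernel_upper_positive (X^-1) (Y^-1) x01.
have ineq : c * h 1%N <= X^-1 ^+ 2 * (2 * X) + Y^-1 ^+ 2 * (2 * Y).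
  have x1' : `|x| <= 1 by rewrite gtr0_norm// ltW.
  have x1n : `|- x| <= 1 by rewrite normrN.
  set A := X^-1 ^+ 2; set B := Y^-1 ^+ 2.
  have A0 : 0 <= A by exact: sqr_ge0.
  have B0 : 0 <= B by exact: sqr_ge0.
  apply/ler_addgt0Pr => e e0.
  have [M1 hM1] := kernel_ge0 gh uh gk uk (half_gt0 e0).
  have D0 : 0 <= (A + B) * C by rewrite mulr_ge0 ?addr_ge0.
  have [M2 hM2] := expr_small D0 s01 (half_gt0 e0).
  pose M := maxn 1 (maxn M1 M2).
  have M11 : (1 < M.+1)%N by rewrite ltnS /M leq_max leqnn.
  have M1M : (M1 <= M.+1)%N by rewrite leqW// /M !leq_max leqnn orbT.
  have M2M : (M2 <= M)%N by rewrite /M !leq_max leqnn !orbT.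
  have := hM1 _ M1M; have := hM2 _ M2M => a5.
  have -> : \sum_(1 <= n < M.+1) h n * test_kernel A B c x n =
     A * (\sum_(1 <= n < M.+1) h n * x ^+ n) - B * (\sum_(1 <= n < M.+1) h n * (- x) ^+ n)
     - c * h 1%N.
    have -> : c * h 1%N = \sum_(1 <= n < M.+1) h n * (if n == 1%N then c else 0).
      rewrite big_ltn// eqxx mulrC big_nat big1 ?addr0// => n /andP[n1 _].
      by rewrite gtn_eqF// mulr0.
    rewrite !mulr_sumr -!sumrB; apply: eq_bigr => n _; rewrite /test_kernel -/A -/B.
    by move: (h n) (x ^+ n) ((- x) ^+ n) (if _ then _ else _) => *; ring.
  have := hT M x x1'; have := hT M (- x) x1n.
  set T1 := \sum_(_ <= _ < _) _; set T2 := \sum_(_ <= _ < _) _; set E := C * s ^+ M.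
  rewrite !ler_norml => /andP[a1 a2] /andP[a3 a4] a6.
  have t1 : T x <= 2 * X by rewrite /T /X /beta; have := atan_ltpi2 ((q.[x] - u) / v); lra.
  have t2 : - (2 * Y) <= T (- x).
    by rewrite /T /Y /beta; have := atan_gtNpi2 ((q.[- x] - u) / v); lra.
  have b1 : A * T2 <= A * (2 * X) + A * E by rewrite -mulrDr; apply: ler_wpM2l => //; lra.
  have b2 : - (B * T1) <= B * (2 * Y) + B * E.
    by rewrite -mulrDr -mulrN; apply: ler_wpM2l => //; lra.
  have a5' : A * E + B * E < e / 2 by rewrite -mulrDl /E mulrA.
  move: b1 b2 a5' a6.
  move: (A * _) (A * _) (A * _) (B * _) (B * _) (B * _) (c * _) => *; lra.
have cosb : v = normc w * cos beta.
  rewrite /beta cos_atan; have nw : 0 < normc w by rewrite normc_gt0.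
  have -> : 1 + (u / v) ^+ 2 = (normc w / v) ^+ 2.
    by rewrite !exprMn !exprVn sqr_normcE -/u -/v; field; exact: (lt0r_neq0 v0).
  rewrite sqrtr_sqr ger0_norm ?divr_ge0 ?(ltW nw) ?(ltW v0)//.
  by rewrite invfM invrK mulrA divff ?mul1r// gt_eqF.
have trig : X * Y * normc w <= pi * v.
  rewrite cosb mulrCA [X * Y * _]mulrC; apply: ler_wpM2l; first exact: normc_ge0.
  apply: pi_cos_ge; rewrite ler_norml.
  by apply/andP; split; [move: X0|move: Y0]; rewrite /X /Y; lra.
have XYp : X + Y = pi by rewrite /X /Y; field.
have nw : 0 < normc w by rewrite normc_gt0.
by move: ineq; rewrite h1; apply: covering_algebra XYp trig => //; exact: ltW.
Qed.

End Covering.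
End PolynomialCovering.

(** * The covering theorem *)

Section DiskCovered.
Variable R : realType.
Variables (b : nat -> R) (f : R[i] -> R[i]).
Hypothesis b1 : b 1%N = 1.
Hypothesis hf : holomorphic_on_disk f.
Hypothesis fE : forall z, normc z < 1 -> sums_to (fun n => (b n)%:C) z (f z).
Hypothesis tf : typically_real f.

Lemma psum_uniform r e : 0 < r < 1 -> 0 < e -> exists M0, forall M, (M0 <= M)%N ->
  forall z, normc z <= 1 -> normc (psum (fun n => b n * r ^+ n) M z - f (r%:C * z)) <= e.
Proof.
move=> r01 e0; have /andP[r0 r1] := r01.
have [C [s [C0 s01 hC]]] := series_geometric_bound fE r01; have /andP[s0 s1] := s01.
have s10 : 0 < 1 - s by rewrite subr_gt0.
have D0 : 0 <= C / (1 - s) by rewrite divr_ge0// ltW.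
have [M0 hM0] := expr_small D0 s01 e0; exists M0.+1 => M hM z z1.
have M1 : (0 < M)%N by exact: leq_trans hM.
have nrz : normc (r%:C * z) < 1.
  by rewrite normcM normcR gtr0_norm//; apply: le_lt_trans r1; rewrite ler_piMr// ltW.
apply/ler_addgt0Pr => d d0; have [N0 hN] := fE nrz d0.
have := hN _ (leq_maxr M N0); rewrite -/(psum b _ _) -psum_scale.
rewrite (psum_split _ _ M1 (leq_maxl _ _)).
set S := psum _ M z; set T := \sum_(_ <= _ < _) _ => hS.
have hT : normc T <= e.
  apply: (le_trans (normc_sum _ _ _)).
  apply: (@le_trans _ _ (\sum_(M <= n < maxn M N0) C * s ^+ n)).
    rewrite !big_nat; apply: ler_sum => n /andP[n0 _].
    apply: le_trans (hC n); rewrite normcM normcR normcX ler_wpM2l//.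
    apply: (@le_trans _ _ 1); first by rewrite exprn_ile1// normc_ge0.
    by rewrite ler1n (leq_trans M1).
  rewrite -mulr_sumr; apply: le_trans (ltW (hM0 M (ltnW hM))).
  rewrite -mulrA; apply: ler_wpM2l => //; rewrite mulrC.
  by apply: geometric_tail => //; [exact: ltW|exact: leq_maxl].
have -> : S - f (r%:C * z) = (S + T - f (r%:C * z)) - T by ring.
by apply: (le_trans (le_normcD _ _)); rewrite normcN addrC lerD// ltW.
Qed.

(** The gap [d] leaves room both for moving the omitted value off the real axis and for replacing
    [f] by a polynomial. *)
Lemma away_from_omitted_value w r : 0 < r < 1 -> (forall z, normc z < 1 -> f z != w) ->
  exists2 d, 0 < d & forall z, normc z <= r -> d <= normc (f z - w).
Proof.
move=> /andP[r0 r1] hw.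
have [|z zr zmin] := @closed_disk_max _ (fun z => - normc (f z - w)) r (ltW r0).
  move=> z zr e e0; have z1 := le_lt_trans zr r1.
  have /continuous_normcP/(_ e e0)[d d0 hd] := derivable_continuous_normc (hf z1).
  exists d => // y /hd; apply: le_lt_trans; rewrite ler_norml.
  have h1 := ler_normcB (f y - w) (f z - w); have h2 := ler_normcB (f z - w) (f y - w).
  have E : f y - w - (f z - w) = f y - f z by ring.
  rewrite -[f z - w - _]opprB normcN in h2; rewrite E in h1 h2.
  by apply/andP; split; lra.
exists (normc (f z - w)); first by rewrite normc_gt0 subr_eq0 hw// (le_lt_trans zr).
by move=> y /zmin; rewrite lerN2.
Qed.

(** The polynomial estimate is applied to a truncation of [f (r z) + e z], with the same [r] as
    point of the test kernel. Its bound [(r + e) r / (2 (1 + r^2))] is at least [r^2 / 4] because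
    [1 + r^2 <= 2]. *)
Lemma omitted_value_upper w r d : 0 < r < 1 -> 0 < Im w -> 0 < d ->
  (forall z, normc z <= r -> d <= normc (f z - w)) -> r ^+ 2 / 4 <= normc w.
Proof.
move=> r01 Iw d0 hd; have /andP[r0 r1] := r01.
(* The truncation error and the correction [e z] together move a value by at most [2 e < d], so the
   polynomial still omits [w]. *)
pose e := d / 4; have e0 : 0 < e by rewrite divr_gt0.
have gb := series_geometric_bound fE r01.
have ub := series_upper_positive fE tf r01.
have [M1 hM1] := truncation gb ub e0; have [M2 hM2] := psum_uniform r01 e0.
pose M := maxn 2 (maxn M1 M2).
have M2' : (2 <= M)%N by rewrite leq_max leqnn.
have M1M : (M1 <= M)%N by rewrite /M !leq_max leqnn orbT.
have M2M : (M2 <= M)%N by rewrite /M !leq_max leqnn !orbT.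
have {}hM1 := hM1 _ M1M; have {}hM2 := hM2 _ M2M; clearbody M.
pose q : {poly R} := \sum_(1 <= n < M) (b n * r ^+ n) *: 'X^n + e *: 'X.
have qE z : (map_poly (real_complex R) q).[z] = psum (fun n => b n * r ^+ n) M z + e%:C * z.
  rewrite rmorphD rmorph_sum /= map_polyZ map_polyX !hornerE horner_sum; congr (_ + _).
  by apply: eq_bigr => n _; rewrite map_polyZ map_polyXn hornerZ hornerXn.
have q0 : q.[0] = 0.
  rewrite hornerD horner_sum hornerZ hornerX mulr0 addr0 big_nat.
  by apply: big1 => n /andP[n0 _]; rewrite hornerZ hornerXn expr0n gtn_eqF ?mulr0.
have q1 : q^`().[0] = r + e.
  rewrite horner_coef0 coef_deriv mulr1n coefD coefZ coefX eqxx mulr1; congr (_ + _).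
  rewrite coef_sum big_ltn// coefZ coefXn eqxx b1 expr1 mul1r mulr1 big_nat big1 ?addr0//.
  by move=> n /andP[n2 _]; rewrite coefZ coefXn ltn_eqF ?mulr0.
have Pw z : normc z <= 1 -> (map_poly (real_complex R) q).[z] != w.
  move=> z1; rewrite qE; apply: contraTneq (hM2 z z1) => E.
  have nrz : normc (r%:C * z) <= r.
    by rewrite normcM normcR gtr0_norm// ler_piMr// ltW.
  have := hd _ nrz => h; rewrite -ltNge.
  have Ew : normc (f (r%:C * z) - w)
      = normc (psum (fun n => b n * r ^+ n) M z - f (r%:C * z) + e%:C * z).
    by rewrite normcB -E addrAC.
  move: h; rewrite Ew => /le_trans/(_ (le_normcD _ _)).
  rewrite normcM normcR gtr0_norm//.
  have : e * normc z <= e by rewrite ler_piMr// ltW.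
  have : d = 4 * e by rewrite /e; field.
  move: (normc _) (e * _) => *; lra.
have Pup z : normc z = 1 -> 0 < Im z -> 0 <= Im (map_poly (real_complex R) q).[z].
  by move=> z1 Iz; rewrite qE -(pmulr_lge0 _ Iz) hM1.
have q10 : 0 <= q^`().[0] by rewrite q1 addr_ge0// ltW.
have := polynomial_covering q0 Iw Pw Pup r01 q10; rewrite q1; apply: le_trans.
have x20 : 0 < 2 * (1 + r ^+ 2) by rewrite mulr_gt0// ltr_pwDl// sqr_ge0.
rewrite ler_pdivlMr//.
have r2 : r ^+ 2 <= 1 by rewrite expr_le1// ltW.
have r20 : 0 <= r ^+ 2 by exact: sqr_ge0.
have re : 0 <= e * r by rewrite mulr_ge0// ltW.
have -> : (r + e) * r = r ^+ 2 + e * r by ring.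
by move: (r ^+ 2) (e * r) r2 r20 re => y t *; nra.
Qed.

Lemma disk_covered w : normc w < 1 / 4 -> exists2 z, normc z < 1 & f z = w.
Proof.
move=> w4; apply: contrapT => nex.
have hw z : normc z < 1 -> f z != w by move=> z1; apply/eqP => E; apply: nex; exists z.
(* The arithmetic mean of 1 and [4 |w|]: it is below 1, and its square exceeds [4 |w|] strictly. *)
have N0 := normc_ge0 w; pose r := (1 + 4 * normc w) / 2.
have r0 : 0 < r by rewrite /r; lra.
have r1 : r < 1 by rewrite /r; lra.
have r01 : 0 < r < 1 by rewrite r0.
have gap : normc w < r ^+ 2 / 4.
  have : 0 < (1 - 4 * normc w) ^+ 2 by rewrite exprn_gt0//; lra.
  by rewrite /r; lra.
have [d d0 hd] := away_from_omitted_value r01 hw.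
have [w' [w'n w'I hd']] : exists w', [/\ normc w' = normc w, 0 <= Im w' &
    forall z, normc z <= r -> d <= normc (f z - w')].
  case: (leP 0 (Im w)) => Iw; first by exists w.
  exists w^*%C; split; first exact: normc_conj.
    by move: Iw; case: (w) => x y /= ?; rewrite oppr_ge0 ltW.
  move=> z zr; have zr' : normc z^*%C <= r by rewrite normc_conj.
  have := hd _ zr'; rewrite (series_conj fE); last exact: le_lt_trans r1.
  by rewrite -[normc (_ - w^*%C)]normc_conj rmorphB /= conjcK.
(* An upward shift that makes the imaginary part positive, while keeping half of the distance to the
   image and half of the gap between [|w|] and [r^2 / 4]. *)
pose eta := Num.min (d / 2) ((r ^+ 2 / 4 - normc w) / 2).
have eta0 : 0 < eta by rewrite lt_min !divr_gt0// subr_gt0.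
have [e1 e2] : eta <= d / 2 /\ eta <= (r ^+ 2 / 4 - normc w) / 2.
  by split; rewrite ge_min lexx ?orbT.
pose w1 := w' + (0 +i* eta).
have ne : normc (0 +i* eta) = eta by rewrite /= expr0n add0r sqrtr_sqr gtr0_norm.
have Iw1 : 0 < Im w1 by rewrite cImD /= ltr_wpDl.
have hd1 z : normc z <= r -> d / 2 <= normc (f z - w1).
  move=> /hd' h; have := ler_normcB (f z - w') (0 +i* eta).
  have -> : f z - w' - (0 +i* eta) = f z - w1 by rewrite /w1; ring.
  by rewrite ne; lra.
have := omitted_value_upper r01 Iw1 (half_gt0 d0) hd1.
have := le_normcD w' (0 +i* eta); rewrite ne w'n -/w1; lra.
Qed.

Lemma dist0_boundary_ge : ((1 / 4)%:E <= dist0_boundary f)%E.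
Proof.
apply/ereal_infP => _ [w [_ wi] <-]; rewrite lee_fin leNgt; apply/negP => w4.
apply: wi; apply/nbhs_normcP; exists (1 / 4 - normc w); first by rewrite subr_gt0.
move=> y hy; have [|z z1 <-] := @disk_covered y; last by exists z.
have := ler_normcB y w; lra.
Qed.

End DiskCovered.

(** * The Koebe function *)

Section Koebe.
Variable R : realType.
Implicit Types (x y r e : R) (z u : R[i]).

Lemma sum_natX (F : fieldType) (x : F) k : 1 - x != 0 ->
  \sum_(2 <= n < k.+2) n%:R * x ^+ n = x / (1 - x) ^+ 2 - x
    - x ^+ k.+2 * (k.+2%:R - k.+1%:R * x) / (1 - x) ^+ 2.
Proof.
move=> x1; elim: k => [|k IH].
  by rewrite big_geq//; field.
rewrite big_nat_recr//= IH !exprS -!natr1; move: (x ^+ k) (k%:R) => y n.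
by field.
Qed.

Lemma sum_natX2 (F : fieldType) (y : F) k : 1 - y != 0 ->
  \sum_(2 <= n < k.+2) n%:R ^+ 2 * y ^+ n = y * (1 + y) / (1 - y) ^+ 3 - y
    - y ^+ k.+2 * (k.+2%:R ^+ 2 - (2 * k.+2%:R ^+ 2 - 2 * k.+2%:R - 1) * y
                   + k.+1%:R ^+ 2 * y ^+ 2) / (1 - y) ^+ 3.
Proof.
move=> y1; elim: k => [|k IH].
  by rewrite big_geq//; field.
rewrite big_nat_recr//= IH !exprS -!natr1; move: (y ^+ k) (k%:R) => t n.
by field.
Qed.

Lemma natX_small x e : 0 <= x < 1 -> 0 < e ->
  exists N0, forall N, (N0 <= N)%N -> N%:R * x ^+ N < e.
Proof.
move=> /andP[x0 x1] e0; pose s := (1 + x) / 2; pose t := x / s.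
have [xs s1] : x < s /\ s < 1 by rewrite /s; split; lra.
have s0 : 0 < s by exact: le_lt_trans xs.
have [t0 t1] : 0 <= t /\ t < 1 by rewrite divr_ge0 ?(ltW s0)// ltr_pdivrMr// mul1r.
have xE : x = t * s by rewrite /t divfK// gt_eqF.
have D0 : 0 <= (1 - t)^-1 by rewrite invr_ge0 subr_ge0 ltW.
have s01 : 0 < s < 1 by rewrite s0.
have [N0 hN] := expr_small D0 s01 e0; exists N0 => N /hN; apply: le_lt_trans.
rewrite xE exprMn mulrA; apply: ler_wpM2r; last exact: natr_expr_le.
by rewrite exprn_ge0// ltW.
Qed.

Lemma nneseries_EFin (a : nat -> R) l :
  (forall e, 0 < e -> exists N0, forall k, (N0 <= k)%N ->
     `|\sum_(2 <= n < k.+2) a n - l| <= e) ->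
  (\sum_(2 <= n <oo) (a n)%:E = l%:E)%E.
Proof.
move=> h; apply/cvg_lim => //.
have -> : (fun n => \sum_(2 <= k < n) (a k)%:E)%E = (fun n => (\sum_(2 <= k < n) a k)%:E).
  by apply/funext => n; rewrite sumEFin.
apply/fine_cvgP; split; first by apply: nearW.
apply/cvgrPdist_le => e /h[N0 hN]; exists N0.+2 => // -[|[|n]]//=.
by rewrite !ltnS => /hN; rewrite distrC.
Qed.

Lemma nneseries_natX x : 0 <= x < 1 ->
  (\sum_(2 <= n <oo) (n%:R * x ^+ n)%:E = (x / (1 - x) ^+ 2 - x)%:E)%E.
Proof.
move=> x01; have /andP[x0 x1] := x01; have x10 : 0 < 1 - x by rewrite subr_gt0.
apply: nneseries_EFin => e e0.
have e0' : 0 < e * (1 - x) ^+ 2 by rewrite mulr_gt0// exprn_gt0.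
have [N0 hN] := natX_small x01 e0'; exists N0 => k kN.
rewrite sum_natX ?gt_eqF// addrAC subrr add0r normrN.
have kN2 : (N0 <= k.+2)%N by rewrite (leq_trans kN)// -addn2 leq_addr.
have h := hN _ kN2.
have k0 : 0 <= k.+1%:R * x by rewrite mulr_ge0.
have k1 : k.+1%:R * x <= k.+2%:R.
  by apply: (@le_trans _ _ k.+1%:R); [rewrite ler_piMr// ltW|rewrite ler_nat].
have xk : 0 <= x ^+ k.+2 by rewrite exprn_ge0.
rewrite ger0_norm; last first.
  by apply: divr_ge0; [apply: mulr_ge0; rewrite ?subr_ge0|exact: sqr_ge0].
rewrite ler_pdivrMr ?exprn_gt0//; apply: le_trans (ltW h).
by rewrite mulrC; apply: ler_wpM2r => //; rewrite gerBl.
Qed.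

(** With [y = x^2], the sum of [n^2 y^n] from index 1 is [y (1 + y) / (1 - y)^3]; dropping the first
    term gives the stated numerator, and the denominator is [(1 - x^2)^3] expanded. *)
Lemma nneseries_natX2 x : 0 <= x < 1 ->
  (\sum_(2 <= n <oo) (n%:R ^+ 2 * x ^+ (2 * n))%:E
     = (x ^+ 4 * (x ^+ 4 - 3 * x ^+ 2 + 4) / (1 - 3 * x ^+ 2 + 3 * x ^+ 4 - x ^+ 6))%:E)%E.
Proof.
move=> x01; have /andP[x0 x1] := x01; pose y := x ^+ 2.
have y0 : 0 <= y by exact: sqr_ge0.
have y1 : y < 1 by rewrite /y expr_lt1.
have y10 : 0 < 1 - y by rewrite subr_gt0.
have -> : 1 - 3 * x ^+ 2 + 3 * x ^+ 4 - x ^+ 6 = (1 - y) ^+ 3 by rewrite /y; ring.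
have -> : x ^+ 4 * (x ^+ 4 - 3 * x ^+ 2 + 4) / (1 - y) ^+ 3
    = y * (1 + y) / (1 - y) ^+ 3 - y.
  have -> : x ^+ 4 = y ^+ 2 by rewrite /y; ring.
  by rewrite -/y; clearbody y; field; rewrite gt_eqF.
apply: nneseries_EFin => e e0.
(* The remainder is at most [4 (m x^m)^2 / (1 - y)^3] with [m = k + 2]; the bound [d <= 1] lets the
   square of [m x^m] be controlled by [d] itself. *)
pose d := Num.min 1 (e * (1 - y) ^+ 3 / 4).
have d0 : 0 < d by rewrite lt_min ltr01 divr_gt0// mulr_gt0// exprn_gt0.
have [d1 d2] : d <= 1 /\ d <= e * (1 - y) ^+ 3 / 4 by split; rewrite ge_min lexx ?orbT.
have [N0 hN] := natX_small x01 d0; exists N0 => k kN.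
have kN2 : (N0 <= k.+2)%N by rewrite (leq_trans kN)// -addn2 leq_addr.
have := hN _ kN2; set m : R := k.+2%:R => h.
under eq_bigr do rewrite exprM -/y.
rewrite sum_natX2 ?gt_eqF// addrAC subrr add0r normrN -/m.
have m2 : 2 <= m by rewrite /m ler_nat.
have kE : k.+1%:R = m - 1 by rewrite /m -[k.+2%:R]natr1 addrK.
rewrite kE.
have b1 : 0 <= m ^+ 2 - (2 * m ^+ 2 - 2 * m - 1) * y + (m - 1) ^+ 2 * y ^+ 2.
  have -> : m ^+ 2 - (2 * m ^+ 2 - 2 * m - 1) * y + (m - 1) ^+ 2 * y ^+ 2
    = (m - (m - 1) * y) ^+ 2 + y by ring.
  by rewrite addr_ge0// sqr_ge0.
have b2 : m ^+ 2 - (2 * m ^+ 2 - 2 * m - 1) * y + (m - 1) ^+ 2 * y ^+ 2 <= 4 * m ^+ 2.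
  have -> : m ^+ 2 - (2 * m ^+ 2 - 2 * m - 1) * y + (m - 1) ^+ 2 * y ^+ 2
    = (m - (m - 1) * y) ^+ 2 + y by ring.
  have q0 : 0 <= (m - 1) * y by rewrite mulr_ge0//; lra.
  have q1 : (m - 1) * y <= m - 1 by rewrite ler_piMr ?(ltW y1)//; lra.
  have : (m - (m - 1) * y) ^+ 2 <= m ^+ 2.
    by rewrite ler_pXn2r ?nnegrE//; lra.
  have : 1 <= m ^+ 2 by rewrite expr_ge1//; lra.
  by lra.
have yk : 0 <= y ^+ k.+2 by rewrite exprn_ge0.
rewrite ger0_norm; last first.
  by apply: divr_ge0; [exact: mulr_ge0|apply: exprn_ge0; exact: ltW].
rewrite ler_pdivrMr ?exprn_gt0//.
apply: (le_trans (ler_wpM2l yk b2)).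
have -> : y ^+ k.+2 * (4 * m ^+ 2) = 4 * (m * x ^+ k.+2) ^+ 2.
  by rewrite /y exprAC; ring.
have h0 : 0 <= m * x ^+ k.+2 by rewrite mulr_ge0 ?exprn_ge0//; lra.
have : (m * x ^+ k.+2) ^+ 2 <= d.
  by rewrite expr2; apply: (le_trans (ler_wpM2l h0 (le_trans (ltW h) d1))); rewrite mulr1 ltW.
by move: d2; rewrite ler_pdivlMr//; lra.
Qed.

Lemma normc_nat n : normc (n%:R : R[i]) = n%:R.
Proof. by rewrite -(rmorph_nat (real_complex R)) normcR ger0_norm. Qed.

(** The origin of [Ffun]: it is the left-hand side for the extremal coefficients [n], minus the
    extremal distance [1/4]. *)
Lemma lhs_nat (Phi : R -> R) x : 0 <= x < 1 ->
  lhs Phi (fun n => n%:R) x = (Ffun Phi x + 1 / 4)%:E.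
Proof.
move=> x01; rewrite /lhs.
under eq_eseriesr do rewrite normc_nat.
under [X in (_ + _ * X)%E]eq_eseriesr do rewrite normc_nat.
rewrite nneseries_natX// nneseries_natX2// -EFinM -!EFinD /Ffun.
by congr EFin; rewrite [x + _]addrC subrK subrK.
Qed.

Lemma lhs_le (Phi : R -> R) (a : nat -> R[i]) x y : 0 <= x -> x <= y ->
  0 <= Phi x -> Phi x <= Phi y -> (forall n, (1 < n)%N -> normc (a n) <= n%:R) ->
  (lhs Phi a x <= lhs Phi (fun n => n%:R) y)%E.
Proof.
move=> x0 xy P0 Pxy ha; have y0 := le_trans x0 xy.
have Xle n : x ^+ n <= y ^+ n by rewrite lerXn2r ?nnegrE.
(* Recording the lower index as a predicate makes [1 < n] available in the termwise comparison,
   where the coefficient bound needs it. *)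
have red (c : nat -> R) : (\sum_(2 <= n <oo) (c n)%:E
    = \sum_(2 <= n <oo | (1 < n)%N) (c n)%:E)%E.
  congr (limn _); apply/funext => N; rewrite big_nat_cond [RHS]big_nat_cond.
  by apply: eq_bigl => n; case: (1 < n)%N; rewrite ?andbT.
rewrite /lhs; apply: leeD; first apply: leeD.
- by rewrite lee_fin.
- rewrite !red; apply: lee_nneseries => [n _ _|n n1].
    by rewrite lee_fin mulr_ge0 ?normc_ge0// exprn_ge0.
  by rewrite lee_fin normc_nat; apply: ler_pM; rewrite ?normc_ge0 ?exprn_ge0 ?ha.
- apply: lee_pmul; rewrite ?lee_fin//.
    by apply: nneseries_ge0 => n _ _; rewrite lee_fin mulr_ge0 ?sqr_ge0// exprn_ge0.
  rewrite !red; apply: lee_nneseries => [n _ _|n n1].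
    by rewrite lee_fin mulr_ge0 ?sqr_ge0// exprn_ge0.
  rewrite lee_fin normc_nat; apply: ler_pM; rewrite ?sqr_ge0 ?exprn_ge0//.
  by rewrite lerXn2r ?nnegrE ?normc_ge0 ?ha.
Qed.

(** Strictness comes from the first summand, through [y (1 - x)^2 - x (1 - y)^2 = (y - x) (1 - x
    y)]. The rational factor of [Phi] is monotone because it is a power series with nonnegative
    coefficients. *)
Lemma Ffun_lt (Phi : R -> R) x y : 0 <= x -> x < y -> y < 1 ->
  0 <= Phi x -> Phi x <= Phi y -> Ffun Phi x < Ffun Phi y.
Proof.
move=> x0 xy y1 P0 Pxy; have y0 := le_trans x0 (ltW xy); have x1 := lt_trans xy y1.
have Xle n : x ^+ n <= y ^+ n by rewrite lerXn2r ?nnegrE// ltW.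
have x01 : 0 <= x < 1 by rewrite x0.
have y01 : 0 <= y < 1 by rewrite y0.
rewrite /Ffun ltrD2r; apply: ltr_leD.
  rewrite ltr_pdivrMr ?exprn_gt0 ?subr_gt0// mulrAC ltr_pdivlMr ?exprn_gt0 ?subr_gt0//.
  have : 0 < (y - x) * (1 - x * y).
    rewrite mulr_gt0 ?subr_gt0//; apply: le_lt_trans y1.
    by rewrite ler_piMl// (ltW x1).
  lra.
apply: ler_pM => //.
  rewrite -lee_fin -nneseries_natX2//; apply: nneseries_ge0 => n _ _.
  by rewrite lee_fin mulr_ge0 ?sqr_ge0// exprn_ge0.
rewrite -lee_fin -!nneseries_natX2//; apply: lee_nneseries => [n _ _|n _].
  by rewrite lee_fin mulr_ge0 ?sqr_ge0// exprn_ge0.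
by rewrite lee_fin ler_wpM2l ?sqr_ge0.
Qed.

(** * Admissibility of the Koebe function and its distance to the boundary *)

Definition koebe z : R[i] := z * ((1 - z) * (1 - z))^-1.

Lemma normc_lt1_neq z : normc z < 1 -> 1 - z != 0.
Proof. by apply: contraTneq => /eqP; rewrite subr_eq0 => /eqP <-; rewrite normc1 ltxx. Qed.

Lemma koebe_holomorphic : holomorphic_on_disk koebe.
Proof.
move=> z /normc_lt1_neq z1.
have d1 : derivable ((fun u => 1 - u) : R[i]^o -> R[i]^o) z 1.
  by apply: (@derivableB _ R[i]^o R[i]^o (cst 1) id); [exact: derivable_cst|exact: derivable_id].
apply: (@derivableM _ R[i]^o id (fun u => ((1 - u) * (1 - u))^-1)); first exact: derivable_id.
apply: (@derivableV _ R[i]^o (fun u => (1 - u) * (1 - u))); first by rewrite mulf_neq0.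
exact: (@derivableM _ R[i]^o (fun u => 1 - u) (fun u => 1 - u)).
Qed.

Lemma koebe_series : power_series_rep (fun n => n%:R) koebe.
Proof.
move=> z z1; have nz := normc_lt1_neq z1; apply/cvgn_normcP => e e0.
have c0 : 0 < normc (1 - z) by rewrite normc_gt0.
have e0' : 0 < e * normc (1 - z) ^+ 2 / 2 by rewrite divr_gt0// mulr_gt0// exprn_gt0.
have z01 : 0 <= normc z < 1 by rewrite normc_ge0.
have [N0 hN] := natX_small z01 e0'; exists N0.+2 => -[|[|k]]// kN.
have kN2 : (N0 <= k.+2)%N by rewrite (leq_trans _ kN)// -addn2 leq_addr.
have := hN _ kN2; rewrite ltr_pdivlMr// => h.
rewrite sum_natX// /koebe -expr2 addrA [z + _]addrC subrK addrAC subrr add0r normcN.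
rewrite normcM normcV normcX ltr_pdivrMr ?exprn_gt0//; apply: le_lt_trans h.
rewrite normcM normcX [leRHS]mulrAC mulrC; apply: ler_wpM2r; first by rewrite exprn_ge0// normc_ge0.
apply: (le_trans (le_normcD _ _)); rewrite normcN normcM !normc_nat mulr2n mulrDr mulr1 lerD2l.
by apply: (@le_trans _ _ k.+1%:R); [rewrite ler_piMr// ltW|rewrite ler_nat].
Qed.

(** Multiplying numerator and denominator by the conjugate of [u = (1 - z)^2] leaves the sign of
    [Im (z * conj u) = Im z * (1 - |z|^2)]. *)
Lemma koebe_typically_real : typically_real koebe.
Proof.
move=> z z1 Iz; have nz := normc_lt1_neq z1.
set u := (1 - z) * (1 - z); have u0 : u != 0 by rewrite mulf_neq0.
have nu : 0 < normc u ^+ 2 by rewrite exprn_gt0// normc_gt0.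
have zE : normc z ^+ 2 < 1 by rewrite expr_lt1// normc_ge0.
have -> : koebe z = (normc u ^- 2)%:C * (z * u^*%C).
  rewrite /koebe -/u; apply: (mulIf u0); rewrite divfK//.
  rewrite -!mulrA [u^*%C * u]mulrC mulc_conj mulrCA -rmorphM mulVf ?mulr1// gt_eqF//.
rewrite cImZ -mulrA pmulr_rgt0 ?invr_gt0//.
have -> : Im (z * u^*%C) * Im z = Im z ^+ 2 * (1 - normc z ^+ 2).
  by rewrite sqr_normcE /u; case: (z) => a b /=; ring.
by rewrite mulr_gt0 ?subr_gt0// exprn_even_gt0.
Qed.

(** Everything follows from [koebe z + 1/4 = (1 + z)^2 / (4 (1 - z)^2)]: it tends to 0 as [z] tends
    to [-1] along the real axis, and vanishes nowhere in the disk. *)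
Lemma koebe_dist0_boundary : (dist0_boundary koebe <= (1 / 4)%:E)%E.
Proof.
apply: ereal_inf_lbound; exists (- (1 / 4))%:C; last by rewrite normcR normrN ger0_norm.
split=> [B /nbhs_normcP[e e0 hB]|].
  pose t := Num.min 2^-1 e.
  have t0 : 0 < t by rewrite lt_min invr_gt0 ltr0n.
  have [t2 te] : t <= 2^-1 /\ t <= e by split; rewrite ge_min lexx ?orbT.
  pose x := 1 - t; have x0 : 0 < x by rewrite /x; lra.
  have x1 : x < 1 by rewrite /x; lra.
  exists (koebe (- x)%:C); split.
    exists (- x)%:C => //; change (normc (- x)%:C < 1).
    by rewrite normcR normrN gtr0_norm.
  apply: hB; rewrite /koebe.
  have -> : (- x)%:C * ((1 - (- x)%:C) * (1 - (- x)%:C))^-1 - (- (1 / 4))%:C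
     = ((1 - x) ^+ 2 / (4 * (1 + x) ^+ 2))%:C.
    rewrite -(rmorph1 (real_complex R)) -!rmorphB -!rmorphM -fmorphV -rmorphM -rmorphB.
    by congr _%:C; field; rewrite ?gt_eqF//; lra.
  rewrite normcR ger0_norm; last by rewrite divr_ge0 ?sqr_ge0// mulr_ge0 ?sqr_ge0.
  rewrite ltr_pdivrMr; last by rewrite mulr_gt0// exprn_gt0//; lra.
  have -> : 1 - x = t by rewrite /x; ring.
  have : 1 < (1 + x) ^+ 2 by rewrite expr_gt1//; lra.
  move: ((1 + x) ^+ 2) => K K1; nra.
move=> /interior_subset[z z1 /eqP]; rewrite /koebe => E.
have nz := normc_lt1_neq z1.
have zN : z = -1.
  have : (1 + z) ^+ 2 = 0.
    move: E; rewrite -subr_eq0 => /eqP E.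
    have -> : (1 + z) ^+ 2 = 4 * ((1 - z) * (1 - z))
      * (z * ((1 - z) * (1 - z))^-1 - (- (1 / 4))%:C).
      rewrite rmorphN rmorphM rmorph1 fmorphV rmorph_nat; field; exact: nz.
    by rewrite E mulr0.
  by move/eqP; rewrite expf_eq0 /= addrC addr_eq0 => /eqP.
by move: z1; rewrite /cdisk /= zN normcN normc1 ltxx.
Qed.

End Koebe.

(** * The inequality up to the root of [Ffun], and its failure beyond it *)

Theorem theorem5p1 (R : realType) (Phi : R -> R) (Rr : R) :
  {within `[0, 1], continuous Phi} ->
  {in `[0, 1] &, {homo Phi : x y / x <= y}} ->
  (forall x, 0 <= x <= 1 -> 0 <= Phi x) ->
  0 < Rr < 1 -> Ffun Phi Rr = 0 ->
  (forall (a : nat -> R[i]) (f w : R[i] -> R[i]),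
     holomorphic_on_disk f -> power_series_rep a f -> typically_real f ->
     schwarz w ->
     forall z : R[i], normc z < 1 -> normc z <= Rr ->
       (lhs Phi a (normc (w z)) <= dist0_boundary f)%E)
  /\
  (forall r : R, Rr < r < 1 ->
     exists (a : nat -> R[i]) (f w : R[i] -> R[i]) (z : R[i]),
       [/\ holomorphic_on_disk f, power_series_rep a f & typically_real f] /\
       [/\ schwarz w, normc z < 1, normc z <= r &
           (dist0_boundary f < lhs Phi a (normc (w z)))%E]).
Proof.
move=> _ mPhi pPhi R01 FR; have /andP[R0 R1] := R01.
have in01 (x : R) : 0 <= x -> x <= 1 -> x \in `[0, 1].
  by move=> x0 x1; apply/mem_set; rewrite /= in_itv /= x0.
split=> [a f w hf pf tf sw z z1 zR|r /andP[Rr_r r1]].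
  have wR : normc (w z) <= Rr := le_trans (schwarz_lemma sw z1) zR.
  have w1 : normc (w z) <= 1 := le_trans wR (ltW R1).
  have [b [b1 aE fE]] := typically_real_series hf pf tf.
  apply: le_trans (dist0_boundary_ge b1 hf fE tf).
  (* The comparison with the extremal coefficients at the radius [Rr] itself, where the left-hand
     side is exactly [1/4]. *)
  apply: (@le_trans _ _ (lhs Phi (fun n => n%:R) Rr)); last first.
    by rewrite lhs_nat ?FR ?add0r// R1 andbT ltW.
  apply: lhs_le => //.
  - exact: normc_ge0.
  - by apply: pPhi; rewrite normc_ge0 w1.
  - by apply: mPhi => //; apply: in01; rewrite ?normc_ge0// ltW.
  - by move=> n n1; rewrite aE// normcR (coefficient_bound b1 fE tf)// ltnW.
have r0 : 0 < r := lt_trans R0 Rr_r.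
have nr : normc r%:C = r by rewrite normcR gtr0_norm.
(* All estimates become equalities here: the coefficients are [n], the identity preserves the
   modulus, and the left-hand side is [Ffun Phi r + 1/4], which exceeds [1/4] by strict
   monotonicity. *)
exists (fun n => n%:R), (@koebe R), id, r%:C; rewrite nr; split.
  by split; [exact: koebe_holomorphic|exact: koebe_series|exact: koebe_typically_real].
split => //; first by split => // z _; exact: derivable_id.
apply: (le_lt_trans (@koebe_dist0_boundary R)).
rewrite lhs_nat ?(ltW r0)// lte_fin ltrDr -FR; apply: Ffun_lt => //; first exact: ltW.
  by apply: pPhi; rewrite !ltW.
by apply: mPhi; rewrite ?in01// ltW.
Qed.
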